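(* For every finite multiset $S$ of integers and every $d\ge 0$, \[ \mathsf{DS}(S,d;\mathbf{x})=\sum_P s_{\lambda(P)'}(\mathbf{x}), \] where $P$ ranges over all Dyck tableaux with entries the multiset $S$ and $\mathrm{di}(\mathrm{RR}(P))=d$, and $\lambda(P)'$ denotes the conjugate partition of the shape $\lambda(P)$.
   Context: Sequences are finite integer sequences indexed from $0$, possibly empty; $|F|$ is the length of $F$. For $x=(x_0,\ldots,x_{m-1})$, $\mathrm{di}(x)=\#\{(i,j):0\le i<j<m,\ x_i=x_j+1\}$. A sequence $x$ is affine Dyck if $x_{i+1}\le x_i+1$ for all $0\le i<m-1$, and dual Dyck if $x_{i+1}\ge x_i+2$ for all $0\le i<m-1$. A factorization of $S$ is an ordered sequence $\mathcal F=(F_0,F_1,F_2,\ldots)$ of finite sequences, all but finitely many empty, such that the concatenation $F_0F_1F_2\cdots$ is a permutation (rearrangement) of the multiset $S$; it is an affine Dyck factorization if each $F_i$ is an affine Dyck sequence, and $\mathrm{di}(\mathcal F)=\mathrm{di}(F_0F_1F_2\cdots)$. Variables are $\mathbf{x}=(x_0,x_1,x_2,\ldots)$. The (affine) Dyck symmetric function is \[ \mathsf{DS}(S,d;\mathbf{x})=\sum_{\mathcal F}\ \prod_{r\ge0}x_r^{|F_r|}, \] the sum over affine Dyck factorizations $\mathcal F$ of $S$ with $\mathrm{di}(\mathcal F)=d$. A Dyck tableau is a left-aligned tableau with rows $T_0,T_1,\ldots,T_{\ell-1}$ from top to bottom (nonempty rows; the tableau with no rows is allowed), with $|T_0|\ge|T_1|\ge\cdots\ge|T_{\ell-1}|$,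 such that each row read left to right is a dual Dyck sequence, and whenever adjacent rows $T_j$ and $T_{j+1}$ both have an entry in column $p$, $T_j[p]\le T_{j+1}[p]+1$. Its row-reading word is $\mathrm{RR}(P)=T_{\ell-1}T_{\ell-2}\cdots T_0$ (rows read left to right, bottom row first). Its shape $\lambda(P)$ is the partition of row lengths. $s_\lambda(\mathbf x)$ is the Schur function in the variables $x_0,x_1,x_2,\ldots$. *)

(* Defs.v *)
From mathcomp Require Import all_boot all_order all_algebra.
From mathcomp Require Import finmap multiset.
From mathcomp Require Import classical_sets fsbigop.
From mathcomp.multinomials Require Import monalg.

Set Implicit Arguments.
Unset Strict Implicit.
Unset Printing Implicit Defensive.

Import Order.TTheory GRing.Theory Num.Theory.

Local Open Scope ring_scope.

(** Formal power series over the integers in the variables x_0, x_1, x_2, ...,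
    given by their coefficients. *)
Definition fps : Type := {cmonom nat} -> int.

Definition fps_monom (m : {cmonom nat}) : fps := fun m' => (m == m')%:R.

(** Formal sum of a possibly infinite family, coefficient by coefficient.
    The finitely supported sum is 0 on a family of infinite support; the
    families summed below are locally finite, so this never happens. *)
Definition fps_sum (I : choiceType) (A : set I) (f : I -> fps) : fps :=
  fun m => \sum_(i \in A) f i m.

Definition di (x : seq int) : nat :=
  #|[set ij : 'I_(size x) * 'I_(size x) |
      (ij.1 < ij.2)%N && (x`_ij.1 == x`_ij.2 + 1)]|.

Definition affine_dyck (x : seq int) : bool :=
  sorted (fun a b => b <= a + 1) x.

Definition dual_dyck (x : seq int) : bool :=
  sorted (fun a b => a + 2 <= b) x.

(** Sequences (F_0, F_1, ...) of finite sequences, almost all empty. *)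
Notation seq_family := {fsfun nat -> seq int with [::]}.

(** F_0 F_1 ... F_N, where N is the largest index with F_N nonempty (N = 0 if
    there is none). *)
Definition concat (F : seq_family) : seq int :=
  flatten [seq F r | r <- iota 0 (\max_(r <- finsupp F) r).+1].

Definition factorization (S : {mset int}%mset) (F : seq_family) : Prop :=
  seq_mset (concat F) = S.

Definition affine_dyck_factorization (S : {mset int}%mset) (F : seq_family) :
  Prop := factorization S F /\ forall r : nat, affine_dyck (F r).

Definition weight (F : seq_family) : {cmonom nat} :=
  \big[mmul/mone]_(r <- finsupp F) expcmn (ucm r) (size (F r)).

Definition DS (S : {mset int}%mset) (d : nat) : fps :=
  fps_sum [set F | affine_dyck_factorization S F /\ di (concat F) = d]%classic
          (fun F => fps_monom (weight F)).

Definition conj_part (la : seq nat) : seq nat :=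
  [seq count (fun l => j < l)%N la | j <- iota 0 (head 0%N la)].

(** A tableau is the list of its rows, from top to bottom; [seq.shape] is then
    the list of its row lengths. *)
Definition dyck_tableau (P : seq (seq int)) : Prop :=
  [/\ [::] \notin P,
      sorted geq (shape P),
      all dual_dyck P &
      forall j p : nat, (j.+1 < size P)%N ->
        (p < size (nth [::] P j))%N -> (p < size (nth [::] P j.+1))%N ->
        (nth [::] P j)`_p <= (nth [::] P j.+1)`_p + 1].

Definition RR (P : seq (seq int)) : seq int := flatten (rev P).

(** Semistandard Young tableaux of shape [la], in English notation, with
    entries in the index set 0, 1, 2, ... of the variables. *)
Definition ssyt (la : seq nat) (T : seq (seq nat)) : Prop :=
  [/\ shape T = la,
      all (sorted leq) T &
      forall j p : nat, (j.+1 < size T)%N ->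
        (p < size (nth [::] T j))%N -> (p < size (nth [::] T j.+1))%N ->
        (nth 0%N (nth [::] T j) p < nth 0%N (nth [::] T j.+1) p)%N].

Definition ssyt_weight (T : seq (seq nat)) : {cmonom nat} :=
  \big[mmul/mone]_(a <- flatten T) ucm a.

Definition schur (la : seq nat) : fps :=
  fps_sum [set T | ssyt la T]%classic (fun T => fps_monom (ssyt_weight T)).

(* Main.v *)
(* Send a word w to the pair (content of w, di w). These pairs form a monoid in
   which concatenation becomes the product, and in its integral monoid algebra
   the letters satisfy x_{i+1} x_i = q x_i x_{i+1}, other pairs of letters
   commuting. Let e_k be the sum of the dual Dyck words of length k. Peeling off
   the smallest letter gives a continuant-like recursion, from which the e_k
   commute with each other.

   Gasharov's argument then gives a Jacobi-Trudi formula: the sum of RR P over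
   the Dyck tableaux P of shape la is det (e_{la_k - k + i}). In an array with a
   flaw, the two tails after the first flaw range over all dual Dyck words of
   the given lengths with letters above a common bound, so they contribute a
   product e_a e_b and can be interchanged. For la = 1^n the tableaux are the
   affine Dyck words of length n, so a product of such sums over n = al_0, al_1,
   ... expands by the Pieri rule into determinants indexed by sequences of
   vertical strips, that is, by semistandard tableaux of content al and
   conjugate shape. Coefficients at (S, d) give the theorem. *)
Require Import Defs.
From HB Require Import structures.
From mathcomp Require Import all_boot all_order all_fingroup all_algebra.
From mathcomp Require Import finmap multiset boolp classical_sets fsbigop.
From mathcomp.multinomials Require Import monalg.
From mathcomp Require Import zify.

Set Implicit Arguments.
Unset Strict Implicit.
Unset Printing Implicit Defensive.

Import Order.TTheory GRing.Theory Num.Theory.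

(** * Columns of semistandard tableaux *)

(** The interchange of tails is an identity between sums and not a bijection of arrays:
    [e_a e_b = e_b e_a] comes from a recursion that matches no individual words. Flaws are therefore
    cancelled between whole signed sums, one column and one adjacent pair of rows at a time, and the
    objects moved are permutations, not arrays. For the same reason commutation is established for
    the sums restricted to letters above an arbitrary bound, since the tails after a flaw obey such
    a bound. Infinite sums are avoided by fixing one monomial [m] of the power series: only finitely
    many variables occur in it, only letters of [S] occur in the words, and a tableau of weight [m]
    has at most as many columns as the degree [L] of [m]. All determinants then have the same size
    [L], with trailing parts 0, at the price of padding tableaux by empty rows or columns and
    stripping them again. *)

Lemma count_lt_sorted (c : seq nat) (r p : nat) : sorted ltn c ->
  (p < count (fun x => x < r) c) = (p < size c) && (nth 0 c p < r).
Proof.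
elim: c p => [|x c IHc] p c_sorted //=.
have := c_sorted; rewrite /= path_sortedE; last exact: ltn_trans.
case/andP=> /allP xc /IHc {}IHc; case: (ltnP x r) => [xr|rx] /=.
  by case: p => [|p]; rewrite ?add1n ?ltnS ?xr //= IHc.
rewrite add0n (_ : count _ c = 0) ?ltn0; last first.
  by apply/eqP; rewrite -leqn0 leqNgt -has_count; apply/hasPn => y /xc /=; lia.
apply/esym/negP => /andP[pc]; case: p pc => [|p] /= pc; first by lia.
by have /= := xc _ (mem_nth 0 pc); lia.
Qed.

Section Columns.

Variables (L : nat) (al : nat -> nat).
Implicit Types (C : {ffun 'I_L -> seq nat}) (e : {ffun 'I_L -> bool}).

Definition add_entry (r : nat) C e : {ffun 'I_L -> seq nat} :=
  [ffun i => if e i then rcons (C i) r else C i].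

Definition part_shape C : bool :=
  [forall i : 'I_L, forall j : 'I_L,
     (j == i.+1 :> nat) ==> (size (C j) <= size (C i))].

(* The columns of the semistandard tableaux of content (al 0, ..., al (K - 1)),
   at most L of them and padded with empty ones, built by adding the entries
   0, 1, ..., K - 1 one vertical strip of the transposed shape at a time. *)
Fixpoint cols (K : nat) : seq {ffun 'I_L -> seq nat} :=
  if K is K'.+1 then
    [seq C <- [seq add_entry K' C e | C <- cols K',
                 e <- enum [pred e : {ffun 'I_L -> bool} | \sum_i e i == al K']]
       | part_shape C]
  else [:: [ffun => [::]]].

(** The last clause is row monotonicity in the form that the recursion of [cols] produces: for each
    [r] the entries below [r] fill a partition shape. [count_gtn_dominates] turns it into a
    comparison of entries. *)
Definition columns_spec (K : nat) C : Prop :=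
  [/\ forall i, sorted ltn (C i) && all (gtn K) (C i),
      forall r, r < K -> \sum_i (r \in C i) = al r
    & forall i j : 'I_L, j = i.+1 :> nat -> forall r, r <= K ->
        count (gtn r) (C j) <= count (gtn r) (C i)].

Lemma all_gtn_filter K (c : seq nat) : all (gtn K) c -> filter (gtn K) c = c.
Proof. by move/all_filterP. Qed.

Lemma split_last K (c : seq nat) : sorted ltn c -> all (gtn K.+1) c ->
  c = if K \in c then rcons (filter (gtn K) c) K else filter (gtn K) c.
Proof.
elim: c => //= x c IHc; rewrite path_sortedE; last exact: ltn_trans.
case/andP => /allP xc c_sorted /andP[xK cK]; rewrite inE.
have {}IHc := IHc c_sorted cK.
have [eKx|Kx] /= := eqVneq K x.
  rewrite -eKx ltnn; case: c xc {IHc c_sorted} cK => // y c xc /= /andP[yK _].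
  by have := xc y (mem_head _ _) => /=; lia.
have -> : x < K by lia.
by case: (K \in c) IHc => /= <-.
Qed.

(** Entries are added in increasing order, so the last strip can be read off and removed; hence
    [cols] lists no tableau twice. *)
Lemma add_entryK K C e : (forall i, all (gtn K) (C i)) ->
  (forall i, (K \in add_entry K C e i) = e i) *
  (forall i, filter (gtn K) (add_entry K C e i) = C i).
Proof.
move=> CK; have KC i : K \notin C i.
  by apply/negP => /(allP (CK i)) /=; rewrite ltnn.
split=> i; rewrite ffunE.
  by case: (e i); rewrite ?mem_rcons ?inE ?eqxx // (negPf (KC i)).
by case: (e i); rewrite ?filter_rcons /= ?ltnn all_gtn_filter.
Qed.

Lemma mem_colsP K C : reflect (columns_spec K C) (C \in cols K).
Proof.
elim: K C => [|K IHK] C.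
  rewrite inE; apply: (iffP eqP) => [->|[CK _ _]].
    by split=> [i|//|i j _ r _]; rewrite ?ffunE.
  by apply/ffunP => i; rewrite ffunE; have /andP[_] := CK i; case: (C i).
rewrite mem_filter; apply: (iffP andP) => [[/forallP Cpart]|[CK Cal Cpart]].
  case/allpairsP => -[C' e] /= [/IHK[CK' Cal' Cpart']]; rewrite mem_enum inE.
  move=> /eqP e_sum CE; have C'K i : all (gtn K) (C' i) by have /andP[] := CK' i.
  have [KC filC] := add_entryK e C'K; rewrite -CE in KC filC.
  have Clt i : all (gtn K.+1) (C i).
    have C'K1 : all (gtn K.+1) (C' i) by apply: sub_all (C'K i) => x /=; lia.
    by rewrite CE ffunE; case: (e i); rewrite ?all_rcons /= ?ltnSn.
  have cnt i r : r <= K -> count (gtn r) (C i) = count (gtn r) (C' i).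
    move=> rK; rewrite -(filC i) count_filter; apply: eq_count => x /=; lia.
  split=> [i|r rK|i j ji r rK].
  - rewrite Clt andbT CE ffunE; have /andP[C's _] := CK' i; case: (e i) => //.
    rewrite -cats1 (sorted_pairwise ltn_trans) pairwise_cat /= andbT.
    by rewrite -(sorted_pairwise ltn_trans) C's andbT allrel1r.
  - have [->|rneK] := eqVneq r K.
      by rewrite -e_sum; apply: eq_bigr => i _; rewrite KC.
    rewrite -Cal'; last by lia.
    by apply: eq_bigr => i _; rewrite -(filC i) mem_filter /=; congr (nat_of_bool _); lia.
  have [rK'|] := leqP r K; first by rewrite !cnt //; apply: Cpart'.
  move=> Kr; have -> : r = K.+1 by lia.
  have size_cnt k : count (gtn K.+1) (C k) = size (C k) by apply/eqP; rewrite -all_count.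
  rewrite !size_cnt; have /forallP/(_ j)/implyP := Cpart i.
  by apply; rewrite ji.
have size_cnt i : count (gtn K.+1) (C i) = size (C i).
  by apply/eqP; rewrite -all_count; have /andP[] := CK i.
split.
  apply/forallP => i; apply/forallP => j; apply/implyP => /eqP ji.
  by rewrite -!size_cnt; apply: Cpart.
apply/allpairsP; exists ([ffun i => filter (gtn K) (C i)], [ffun i => K \in C i]).
split=> /=.
- apply/IHK; split=> [i|r rK|i j ji r rK].
  + rewrite ffunE filter_all andbT; have /andP[Cs _] := CK i.
    by apply: sorted_filter Cs; apply: ltn_trans.
  + rewrite -Cal; last by lia.
    by apply: eq_bigr => i _; rewrite ffunE mem_filter /= rK.
  have cnt i' : count (gtn r) (filter (gtn K) (C i')) = count (gtn r) (C i').
    by rewrite count_filter; apply: eq_count => x /=; lia.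
  by rewrite !ffunE !cnt; apply: Cpart => //; lia.
- rewrite mem_enum inE -(Cal K) //; apply/eqP.
  by apply: eq_bigr => i _; rewrite ffunE.
apply/ffunP => i; rewrite !ffunE; have /andP[Cs CiK] := CK i.
exact: split_last.
Qed.

Lemma cols_uniq K : uniq (cols K).
Proof.
elim: K => //= K IHK; apply: filter_uniq; apply: allpairs_uniq => //.
  exact: enum_uniq.
move=> [C e] [C' e'] /allpairsP[[C1 e1] [/= C1K _ [-> ->]]].
move=> /allpairsP[[C2 e2] [/= C2K _ [-> ->]]] /= E.
have all_lt D : D \in cols K -> forall i, all (gtn K) (D i).
  by move=> /mem_colsP[DK _ _] i; have /andP[] := DK i.
have [K1 f1] := add_entryK e1 (all_lt _ C1K).
have [K2 f2] := add_entryK e2 (all_lt _ C2K).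
congr pair; apply/ffunP => i; first by rewrite -f1 -f2 E.
by rewrite -K1 -K2 E.
Qed.

Lemma cols_part_shape K C : C \in cols K -> forall i j : 'I_L, j = i.+1 :> nat ->
  size (C j) <= size (C i).
Proof.
move=> /mem_colsP[CK _ Cpart] i j ji; have := Cpart i j ji K (leqnn K).
have size_cnt k : count (gtn K) (C k) = size (C k).
  by apply/eqP; rewrite -all_count; have /andP[] := CK k.
by rewrite !size_cnt.
Qed.

Lemma cols_size K C : C \in cols K -> \sum_i size (C i) = \sum_(r < K) al r.
Proof.
elim: K C => [|K IHK] C.
  by rewrite inE => /eqP->; rewrite big_ord0 big1 // => i _; rewrite ffunE.
rewrite mem_filter => /andP[_ /allpairsP[[C' e] /= [C'K]]].
rewrite mem_enum inE => /eqP e_sum ->; rewrite big_ord_recr /= -e_sum -(IHK _ C'K).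
rewrite -big_split; apply: eq_bigr => i _; rewrite ffunE.
by case: (e i); rewrite ?size_rcons /= ?addn1 ?addn0.
Qed.

End Columns.

(** * Transposition *)

Section Transposition.
Implicit Types (la : seq nat) (M : seq (seq nat)).

(** Both sides say that the cell in row [i] and column [j] lies in the diagram of [la]; conjugation
    and transposition are handled through this equivalence. *)
Lemma lt_count_part la i j : sorted geq la ->
  (i < count (fun k => j < k) la) = (j < nth 0 la i).
Proof.
elim: la i => [|k la IH] i /=; first by rewrite nth_nil.
move=> k_la; have {}IH := IH _ (path_sorted k_la).
have le_k i' : nth 0 la i' <= k.
  have [i'la|] := ltnP i' (size la); last by move=> ?; rewrite nth_default.
  move: k_la; rewrite path_sortedE => [/andP[/allP + _]|y x z /= yx zy].
    by move/(_ _ (mem_nth 0 i'la)).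
  exact: leq_trans zy yx.
case: i => [|i] /=; last first.
  case: (ltnP j k) => [jk|kj]; first by rewrite add1n ltnS IH.
  rewrite add0n IH ltnNge (leq_trans (le_k i.+1) kj) ltnNge.
  by rewrite (leq_trans (le_k i) kj).
case: (ltnP j k) => [//|kj]; rewrite add0n IH ltnNge.
by rewrite (leq_trans (le_k _) kj).
Qed.

Lemma size_conj_part la : size (conj_part la) = head 0 la.
Proof. by rewrite size_map size_iota. Qed.

Lemma nth_conj_part la j : sorted geq la ->
  nth 0 (conj_part la) j = count (fun k => j < k) la.
Proof.
move=> la_s; have [jla|laj] := ltnP j (head 0 la).
  by rewrite (nth_map 0) ?size_iota // nth_iota.
rewrite nth_default ?size_conj_part //; apply/esym/eqP; rewrite -leqn0 leqNgt.
by rewrite lt_count_part // nth0 -leqNgt.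
Qed.

Lemma conj_part_sorted la : sorted geq (conj_part la).
Proof.
rewrite sorted_map; apply: (@sub_sorted _ ltn); last exact: iota_ltn_sorted.
by move=> i j /= ij; apply: sub_count => k /=; lia.
Qed.

Lemma conj_part_neq0 la : 0 \notin conj_part la.
Proof.
apply/mapP => -[j]; rewrite mem_iota add0n /= => jla.
apply/eqP; rewrite eq_sym -lt0n -has_count.
by case: la jla => [|k la] //= ->.
Qed.

Lemma conj_partK la : sorted geq la -> 0 \notin la -> conj_part (conj_part la) = la.
Proof.
move=> la_s la0; have cs := conj_part_sorted la.
have sE : size (conj_part (conj_part la)) = size la.
  rewrite size_conj_part -nth0 nth_conj_part //; apply/eqP; rewrite -all_count.
  by apply/allP => k kla; rewrite lt0n; apply: contraNneq la0 => <-.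
apply: (@eq_from_nth _ 0) => // i _; rewrite nth_conj_part //.
apply/eqP; rewrite eqn_leq; apply/andP; split; rewrite leqNgt; apply/negP.
  by rewrite lt_count_part // nth_conj_part // lt_count_part // ltnn.
set k := count _ _ => klt; have : ~~ (k < k) by rewrite ltnn.
by rewrite {2}/k lt_count_part // nth_conj_part // lt_count_part // klt.
Qed.

Definition transp M : seq (seq nat) :=
  [seq [seq nth 0 r j | r <- M & j < size r] | j <- iota 0 (size (head [::] M))].

Lemma shape_transp M : shape (transp M) = conj_part (shape M).
Proof.
rewrite /shape /transp /conj_part -map_comp.
have -> : head 0 (map size M) = size (head [::] M) by case: M.
by apply: eq_map => j; rewrite /= size_map size_filter count_map.
Qed.

Lemma filter_size_take M j : sorted geq (shape M) ->
  [seq r <- M | j < size r] = take (count (fun k => j < k) (shape M)) M.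
Proof.
elim: M => // r M IH /= rM; have {}IH := IH (path_sorted rM).
case: ltnP => [jr|rj]; first by rewrite /= IH.
rewrite add0n; have c0 : count (fun k => j < k) (shape M) = 0.
  move: rM; rewrite path_sortedE => [/andP[/allP rM _]|y x z /= yx zy].
    apply/eqP; rewrite -leqn0 leqNgt -has_count; apply/hasPn => k /rM /=.
    by rewrite -leqNgt => /leq_trans; apply.
  exact: leq_trans zy yx.
by rewrite IH c0 !take0.
Qed.

(** Outside the diagram both sides read the default 0, so the equality covers all [i] and [j]. *)
Lemma nth_transp M i j : sorted geq (shape M) ->
  nth 0 (nth [::] (transp M) j) i = nth 0 (nth [::] M i) j.
Proof.
move=> Ms; have [jM|Mj] := ltnP j (size (head [::] M)).
  rewrite (nth_map 0) ?size_iota // nth_iota // add0n filter_size_take //.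
  set c := count _ _; have cM : c <= size M by rewrite -(size_map size M) count_size.
  have [ic|ci] := ltnP i c.
    by rewrite (nth_map [::]) ?size_takel // nth_take.
  rewrite nth_default ?size_map ?size_takel // nth_default // -nth_shape leqNgt.
  by rewrite -lt_count_part // -leqNgt.
rewrite [nth [::] (transp M) j]nth_default ?size_map ?size_iota // nth_nil.
rewrite nth_default // -nth_shape leqNgt -lt_count_part //.
have : count (fun k => j < k) (shape M) <= 0.
  by rewrite leqNgt lt_count_part // nth_shape nth0 -leqNgt.
by rewrite leqn0 => /eqP->; rewrite ltn0.
Qed.

Lemma transpK M : sorted geq (shape M) -> [::] \notin M -> transp (transp M) = M.
Proof.
move=> Ms M0; have trs : sorted geq (shape (transp M)).
  by rewrite shape_transp conj_part_sorted.
have shE : shape (transp (transp M)) = shape M.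
  rewrite !shape_transp conj_partK //; apply: contra M0 => /mapP[r rM /esym/size0nil r0].
  by rewrite -r0.
have sE : size (transp (transp M)) = size M.
  by rewrite -(size_map size) -/(shape _) shE size_map.
apply: (@eq_from_nth _ [::]) => // i _; apply: (@eq_from_nth _ 0).
  by rewrite -!nth_shape shE.
by move=> j _; rewrite nth_transp // nth_transp.
Qed.

Lemma le_head la k : sorted geq la -> k \in la -> k <= head 0 la.
Proof.
case: la => // k0 la; rewrite /= path_sortedE => [/andP[/allP la_k0 _]|y x z /= yx zy].
  by rewrite inE => /orP[/eqP->//|/la_k0].
exact: leq_trans zy yx.
Qed.

Lemma count_transp M x : sorted geq (shape M) ->
  count_mem x (flatten (transp M)) = count_mem x (flatten M).
Proof.
move=> Ms; rewrite !count_flatten !sumnE !big_map.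
set m := size _; have -> : iota 0 m = index_iota 0 m by rewrite /index_iota subn0.
under eq_bigr do rewrite count_map count_filter -sum1_count big_mkcond.
rewrite exchange_big /= big_seq [RHS]big_seq; apply: eq_bigr => r rM.
have rm : size r <= m.
  have := le_head Ms (map_f size rM); rewrite /m; by case: (M).
rewrite -sum1_count [RHS](big_nth 0) [RHS](big_nat_widen _ _ _ _ _ rm) [RHS]big_mkcond.
by [].
Qed.

Lemma lt_size_transp M j p : sorted geq (shape M) ->
  (p < size (nth [::] (transp M) j)) = (j < size (nth [::] M p)).
Proof.
by move=> Ms; rewrite -!nth_shape shape_transp nth_conj_part // lt_count_part.
Qed.

Definition semistandard_columns M : Prop :=
  all (sorted ltn) M /\ forall i p, i.+1 < size M -> p < size (nth [::] M i.+1) ->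
    nth 0 (nth [::] M i) p <= nth 0 (nth [::] M i.+1) p.

Lemma ssyt_transpP M : sorted geq (shape M) -> [::] \notin M ->
  ssyt (conj_part (shape M)) (transp M) <-> semistandard_columns M.
Proof.
move=> Ms M0.
have lt_size_row (N : seq (seq nat)) p i : p < size (nth [::] N i) -> i < size N.
  by case: (ltnP i (size N)) => // Ni; rewrite nth_default.
split=> [[_ /allP rows cols]|[/allP cols rows]]; split.
- apply/allP => c /(nthP [::])[i iM <-]; apply/(sortedP 0) => p pc.
  rewrite -(nth_transp i p Ms) -(nth_transp i p.+1 Ms); apply: cols.
  - by apply: (lt_size_row (transp M) i); rewrite lt_size_transp.
  - by rewrite lt_size_transp // ltnW.
  - by rewrite lt_size_transp.
- move=> i p iM pc; rewrite -(nth_transp i p Ms) -(nth_transp i.+1 p Ms).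
  have pT : p < size (transp M) by apply: (lt_size_row (transp M) i.+1); rewrite lt_size_transp.
  have /(sortedP 0)/(_ i) := rows _ (mem_nth [::] pT).
  by apply; rewrite lt_size_transp.
- exact: shape_transp.
- apply/allP => r /(nthP [::])[p pT <-]; apply/(sortedP 0) => i.
  rewrite lt_size_transp // => pc; rewrite !nth_transp //; apply: rows => //.
  exact: lt_size_row pc.
move=> j p _ _; rewrite lt_size_transp // => pc; rewrite !nth_transp //.
have /(sortedP 0)/(_ j) := cols _ (mem_nth [::] (lt_size_row _ _ _ pc)).
exact.
Qed.

End Transposition.

(** * Padding by empty columns *)

Lemma sorted_geq_pad (la : seq nat) k : sorted geq la -> sorted geq (la ++ nseq k 0).
Proof.
move=> la_s; have nthE i : nth 0 (la ++ nseq k 0) i = nth 0 la i.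
  by rewrite nth_cat; case: ltnP => // lai; rewrite nth_nseq if_same nth_default.
apply/(sortedP 0) => i _; rewrite !nthE.
have [/(sortedP 0 la_s)//|lai] := ltnP i.+1 (size la).
by rewrite /= [nth 0 la i.+1]nth_default.
Qed.

Section Strip.
Variable T : eqType.
Implicit Types X : seq (seq T).

Definition strip X : seq (seq T) := [seq c <- X | c != [::]].

(** Weakly decreasing sizes put the empty sequences at the end, so stripping loses only their
    number. *)
Lemma strip_pad X : sorted geq (shape X) ->
  X = strip X ++ nseq (size X - size (strip X)) [::].
Proof.
elim: X => // c X IHX cX; have {}IHX := IHX (path_sorted cX); rewrite /= in cX.
case: c cX => [|x c] cX.
  suff X0 : strip X = [::].
    have -> : strip ([::] :: X) = [::] by exact: X0.
    by rewrite subn0 /= {1}IHX X0 subn0.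
  move: cX; rewrite path_sortedE => [/andP[/allP X_0 _]|y a z /= ya zy].
    apply/eqP; rewrite -size_eq0 size_filter -leqn0 leqNgt -has_count.
    apply/hasPn => c' c'X; have := X_0 _ (map_f size c'X) => /=.
    by rewrite leqn0 size_eq0 negbK.
  exact: leq_trans zy ya.
have -> : strip ((x :: c) :: X) = (x :: c) :: strip X by [].
by rewrite /= subSS -IHX.
Qed.

Lemma nth_strip X i : sorted geq (shape X) ->
  nth [::] (strip X) i = nth [::] X i.
Proof.
move=> Xs; rewrite [in RHS](strip_pad Xs) nth_cat; case: ltnP => // iX.
by rewrite nth_nseq if_same nth_default.
Qed.

Lemma strip_sorted X : sorted geq (shape X) -> sorted geq (shape (strip X)).
Proof.
move=> Xs; rewrite /shape (_ : map _ _ = [seq k <- shape X | k != 0]).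
  by apply: sorted_filter Xs => y x z /= yx zy; apply: leq_trans zy yx.
rewrite filter_map; congr map; apply: eq_filter => c /=.
by rewrite size_eq0.
Qed.

Lemma strip_neq_nil X : [::] \notin strip X.
Proof. by rewrite mem_filter eqxx. Qed.

Lemma strip_id X : [::] \notin X -> strip X = X.
Proof.
by move=> X0; apply/all_filterP/allP => c cX; apply: contraNneq X0 => <-.
Qed.

Lemma strip_cat_nseq X k : [::] \notin X -> strip (X ++ nseq k [::]) = X.
Proof.
move=> X0; rewrite /strip filter_cat -/(strip X) strip_id //.
by rewrite (_ : filter _ _ = [::]) ?cats0 //; elim: k.
Qed.

Lemma flatten_strip X : flatten (strip X) = flatten X.
Proof. by elim: X => //= -[|x c] X IHX //=; rewrite IHX. Qed.

End Strip.

(** The cut [r = d_p + 1] gives [c] more than [p] entries that are at most [d_p], hence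
    [c_p <= d_p]. Conversely, if [d] had more entries below [r] than [c], then position
    [p = count (gtn r) c] would carry [c_p <= d_p < r], one entry of [c] below [r] too many. *)
Lemma count_gtn_dominates (K : nat) (c d : seq nat) :
  sorted ltn c -> sorted ltn d -> all (gtn K) d ->
  (forall r, r <= K -> count (gtn r) d <= count (gtn r) c) <->
  (forall p, p < size d -> p < size c /\ nth 0 c p <= nth 0 d p).
Proof.
move=> cs ds dK; split=> [cd p pd|cd r _].
  have dpK : nth 0 d p < K by apply: (allP dK); apply: mem_nth.
  have : p < count (gtn (nth 0 d p).+1) d by rewrite count_lt_sorted // pd /= ltnSn.
  move/leq_trans/(_ (cd _ dpK)); rewrite count_lt_sorted // => /andP[-> ?].
  by split.
rewrite leqNgt; apply/negP; rewrite count_lt_sorted // => /andP[/cd[pc le_cd] dr].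
have := leq_ltn_trans le_cd dr => cr.
have : count (gtn r) c < count (gtn r) c by rewrite count_lt_sorted ?pc.
by rewrite ltnn.
Qed.

(** * Column lists as semistandard tableaux *)

Section Columns.
Variables (L : nat) (al : nat -> nat).
Implicit Types (C : {ffun 'I_L -> seq nat}).

Definition colseq C : seq (seq nat) := [seq C i | i <- enum 'I_L].

Lemma nth_colseq C (i : 'I_L) : nth [::] (colseq C) i = C i.
Proof. by rewrite (nth_map i) ?size_enum_ord // nth_ord_enum. Qed.

Lemma colseq_inj : injective colseq.
Proof. by move=> C C' E; apply/ffunP => i; rewrite -!nth_colseq E. Qed.

Lemma size_colseq C : size (colseq C) = L.
Proof. by rewrite size_map size_enum_ord. Qed.

Lemma colseq_sorted K C : C \in cols L al K -> sorted geq (shape (colseq C)).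
Proof.
move=> CK; apply/(sortedP 0) => i; rewrite size_map size_colseq => iL.
rewrite !nth_shape (nth_colseq C (Ordinal iL)) (nth_colseq C (Ordinal (ltnW iL))) /=.
exact: cols_part_shape CK _ _ _.
Qed.

Lemma count_colseq C r : (forall i, uniq (C i)) ->
  count_mem r (flatten (colseq C)) = \sum_i (r \in C i).
Proof.
move=> Cu; rewrite count_flatten sumnE big_map /colseq big_map big_enum /=.
by apply: eq_bigr => i _; rewrite count_uniq_mem.
Qed.

Lemma colsP K C : C \in cols L al K <->
  [/\ sorted geq (shape (colseq C)), semistandard_columns (strip (colseq C)),
      all (gtn K) (flatten (colseq C))
    & forall r, r < K -> count_mem r (flatten (colseq C)) = al r].
Proof.
have rows_all (P : pred (seq nat)) : all P (colseq C) <-> forall i, P (C i).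
  split=> [/allP CP i|CP]; first by apply: CP; apply: map_f; rewrite mem_enum.
  by apply/allP => c /mapP[i _ ->].
split=> [CK|[Cs [Clt Cle] CK Cal]].
  have Cs := colseq_sorted CK; have /mem_colsP[CKs Cal Cle] := CK.
  split=> //.
  - split.
      by apply/allP => c; rewrite mem_filter => /andP[_ /mapP[i _ ->]]; case/andP: (CKs i).
    move=> i p iM pc; rewrite !nth_strip // in pc *.
    have iL : i.+1 < L.
      rewrite -(size_colseq C) ltnNge; apply/negP => Li.
      by move: pc; rewrite nth_default.
    rewrite (nth_colseq C (Ordinal iL)) (nth_colseq C (Ordinal (ltnW iL))) in pc *.
    have /andP[cs _] := CKs (Ordinal (ltnW iL)); have /andP[ds dK] := CKs (Ordinal iL).
    have dom : forall r, r <= K ->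
        count (gtn r) (C (Ordinal iL)) <= count (gtn r) (C (Ordinal (ltnW iL))).
      exact: Cle.
    by have [] := (count_gtn_dominates cs ds dK).1 dom p pc.
  - apply/allP => x /flattenP[c /mapP[i _ ->]]; have /andP[_ /allP] := CKs i.
    exact.
  move=> r rK; rewrite count_colseq ?Cal // => i; have /andP[Cis _] := CKs i.
  exact: sorted_uniq ltn_trans ltnn _ Cis.
have C_lt i : sorted ltn (C i).
  have [->//|Ci0] := eqVneq (C i) [::].
  by apply: (allP Clt); rewrite mem_filter Ci0 map_f ?mem_enum.
have C_K i : all (gtn K) (C i).
  apply/allP => x xC; apply: (allP CK); apply/flattenP; exists (C i) => //.
  by rewrite map_f ?mem_enum.
apply/mem_colsP; split=> [i|r rK|i j ji].
- by rewrite C_lt C_K.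
- by rewrite -Cal // count_colseq // => i; apply: sorted_uniq ltn_trans ltnn _ (C_lt i).
apply/(count_gtn_dominates (C_lt i) (C_lt j) (C_K j)) => p pj; split.
  apply: leq_trans pj _; rewrite -!nth_colseq -!nth_shape.
  move/(sortedP 0)/(_ i): Cs; rewrite ji; apply; rewrite size_map size_colseq -ji.
  exact: ltn_ord.
have := Cle i p; rewrite -ji !nth_strip // !nth_colseq; apply => //.
rewrite ltnNge; apply/negP => jM; move: pj.
by rewrite -nth_colseq -nth_strip // nth_default.
Qed.

End Columns.

(** * Coefficients of Schur functions *)

Lemma ssyt_weightE (T : seq (seq nat)) r : ssyt_weight T r = count_mem r (flatten T).
Proof.
rewrite /ssyt_weight -sum1_count [RHS]big_mkcond.
elim: (flatten T) => [|a s IHs]; first by rewrite !big_nil cm1.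
by rewrite !big_cons cmM IHs cmU /=; case: eqVneq.
Qed.

Local Open Scope ring_scope.

(** The list [s] also witnesses that finitely many terms contribute at [m], so the sum does not fall
    back on the default 0 of an infinite support. *)
Lemma fps_sum_monom (I : choiceType) (X : set I) (wt : I -> {cmonom nat})
    (m : {cmonom nat}) (s : seq I) :
  uniq s -> (forall i, i \in s <-> X i /\ wt i = m) ->
  fps_sum X (fun i => fps_monom (wt i)) m = (size s)%:R.
Proof.
move=> s_uniq sP; rewrite /fps_sum (fsbigE s) //=.
- rewrite -sum1_size natr_sum big_seq_cond [RHS]big_seq; apply: eq_big => [i|i].
    by case is_ : (i \in s) => //=; have /sP[Xi _] := is_; rewrite mem_set.
  by move=> /andP[/sP[_ wi] _]; rewrite /fps_monom wi eqxx.
- by move=> i /= /sP[].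
move=> i Xi nis; rewrite /fps_monom; case: eqP => // wi.
by case/negP: nis; apply/sP.
Qed.

(** A tableau of weight [m] has at most as many columns as entries, hence at most [L]; padded by
    empty columns it appears exactly once in [cols]. *)
Lemma schur_coef (L K : nat) (al : nat -> nat) (la : seq nat) (m : {cmonom nat}) :
  (\sum_(r < K) al r <= L)%N ->
  (forall r, m r = if (r < K)%N then al r else 0%N) ->
  sorted geq la -> 0%N \notin la ->
  schur (conj_part la) m =
  \sum_(C <- cols L al K) (shape (strip (colseq C)) == la)%:R.
Proof.
move=> le_L mE la_s la0.
pose s := [seq transp (strip (colseq C)) | C <- cols L al K & shape (strip (colseq C)) == la].
rewrite /schur (@fps_sum_monom _ _ _ _ s).
- rewrite size_map size_filter -sum1_count natr_sum big_mkcond /=.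
  by apply: eq_bigr => C _; case: ifP.
- rewrite map_inj_in_uniq ?filter_uniq ?cols_uniq // => C C'.
  rewrite !mem_filter => /andP[_ /colseq_sorted Cs] /andP[_ /colseq_sorted C's].
  move/(congr1 transp); rewrite !transpK ?strip_neq_nil ?strip_sorted // => E.
  by apply: colseq_inj; rewrite (strip_pad Cs) (strip_pad C's) E !size_colseq.
move=> T; split=> [/mapP[C]|[T_ssyt T_m]].
  rewrite mem_filter => /andP[/eqP CE /colsP[Cs Css CK Cal]] ->; split.
    by rewrite /= -CE; apply/ssyt_transpP; rewrite ?strip_neq_nil ?strip_sorted.
  apply/eqP/cmP => r; rewrite ssyt_weightE count_transp ?strip_sorted // flatten_strip mE.
  case: ltnP => [/Cal//|Kr]; apply/eqP; rewrite -leqn0 leqNgt -has_count.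
  by apply/hasPn => x /(allP CK) /=; lia.
have T_shape : shape T = conj_part la by case: T_ssyt.
have Ts : sorted geq (shape T) by rewrite T_shape conj_part_sorted.
have T0 : [::] \notin T.
  apply/negP => T0; have := conj_part_neq0 la; rewrite -T_shape.
  by rewrite (map_f size T0).
pose M := transp T; have Msh : shape M = la by rewrite shape_transp T_shape conj_partK.
have M0 : [::] \notin M.
  by apply/negP => M0; move: la0; rewrite -Msh (map_f size M0).
have TE : T = transp M by rewrite transpK.
have countM r : count_mem r (flatten M) = if (r < K)%N then al r else 0%N.
  by rewrite count_transp // -ssyt_weightE T_m mE.
have M_K : all (gtn K) (flatten M).
  apply/allP => x xM /=; have := countM x; case: ltnP => // _ /eqP.
  by rewrite -leqn0 leqNgt -has_count => /hasPn/(_ x xM) /=; rewrite eqxx.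
have M_L : (size M <= L)%N.
  apply: leq_trans le_L; apply: (@leq_trans (size (flatten M))).
    rewrite size_flatten; elim: (M) M0 => // c M' IH; rewrite inE negb_or => /andP[c0 /IH].
    by case: c c0 => //= x c _; lia.
  rewrite (eq_bigr (fun r : 'I_K => count_mem (r : nat) (flatten M))) => [|r _]; last first.
    by rewrite countM ltn_ord.
  elim: (flatten M) M_K => // x s' IH /= /andP[xK /IH {}IH].
  rewrite big_split /= (bigD1 (Ordinal xK)) //= eqxx -addnA add1n ltnS.
  exact: leq_trans IH (leq_addl _ _).
pose C := [ffun i : 'I_L => nth [::] M i].
have colC : colseq C = M ++ nseq (L - size M) [::].
  apply: (@eq_from_nth _ [::]) => [|i]; rewrite size_colseq.
    by rewrite size_cat size_nseq subnKC.
  move=> iL; rewrite (nth_colseq C (Ordinal iL)) ffunE /= nth_cat.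
  by case: ltnP => // Mi; rewrite nth_nseq if_same nth_default.
have CM : strip (colseq C) = M by rewrite colC strip_cat_nseq.
apply/mapP; exists C; last by rewrite CM TE.
rewrite mem_filter CM Msh eqxx /=; apply/colsP.
have colC_flat : flatten (colseq C) = flatten M by rewrite -flatten_strip CM.
rewrite colC_flat CM; split=> //.
- by rewrite colC /shape map_cat map_nseq -/(shape M) Msh sorted_geq_pad.
- by apply/ssyt_transpP => //; rewrite Msh // -TE.
by move=> r rK; rewrite countM rK.
Qed.

(** * Elementary functions in q-commuting letters *)

Section Continuants.

(** In the application [x 0], [x 1], ... run downwards through consecutive letters, and [E n k] sums
    the products of [k] pairwise non-consecutive letters among [x 0], ..., [x (n - 2)], smallest
    letter first. *)
Variables (A : nzRingType) (q : A) (x : nat -> A) (E : nat -> int -> A).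
Hypothesis q_central : forall y, q * y = y * q.
Hypothesis x_far : forall m n, (m.+1 < n)%N -> x m * x n = x n * x m.
Hypothesis x_near : forall n, x n * x n.+1 = q * x n.+1 * x n.
Hypothesis E0 : forall k, E 0 k = (k == 0)%:R.
Hypothesis E1 : forall k, E 1 k = (k == 0)%:R.
Hypothesis ESS : forall n k, E n.+2 k = E n.+1 k + x n * E n (k - 1).

(** The letters in [E n] have index at most [n - 2], so each is at distance at least 2 from
    [x m]. *)
Lemma continuant_far m n k : (n <= m)%N -> E n k * x m = x m * E n k.
Proof.
elim/ltn_ind: n k => -[|[|n]] IHn k le_n_m.
- by rewrite E0 commr_nat.
- by rewrite E1 commr_nat.
rewrite !ESS mulrDl mulrDr IHn ?ltnS //; last exact: ltnW.
rewrite -mulrA IHn ?ltnS //; last by rewrite (leq_trans _ le_n_m) // -addn2 leq_addr.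
by rewrite !mulrA x_far.
Qed.

Lemma continuant_near n k :
  E n.+2 k * x n.+1 = x n.+1 * E n.+1 k + q * x n.+1 * x n * E n (k - 1).
Proof.
rewrite ESS mulrDl continuant_far // -mulrA (continuant_far _ (leqnSn n)).
by rewrite !mulrA x_near.
Qed.

Lemma continuant_comm n a b : E n a * E n b = E n b * E n a.
Proof.
pose comm n := forall a b, E n a * E n b = E n b * E n a.
(* The cross terms of [E n.+2 a * E n.+2 b]; expanding [mix n.+1] by the recursion
   leaves [mixq n], and conversely. *)
pose mix n (a b : int) := x n * E n a * E n.+1 (b + 1) + E n.+1 (a + 1) * x n * E n b.
pose mixq n a b := E n.+1 a * x n * E n b + q * x n * E n a * E n.+1 b.
suff : [/\ comm n, comm n.+1, forall a b, mix n a b = mix n b a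
         & forall a b, mixq n a b = mixq n b a] by case.
elim: n {a b} => [|n [commn commSn mixC mixqC]].
  split=> a b; rewrite /mix /mixq ?E0 ?E1.
  - by rewrite commr_nat.
  - by rewrite commr_nat.
  - rewrite -!(commr_nat (x 0%N)) -!mulrA -!natrM !mulnb addrC.
    by congr (_ * (_ : bool)%:R + _ * (_ : bool)%:R); exact: andbC.
  rewrite -!(commr_nat (x 0%N)) -!mulrA -!natrM !mulnb.
  by congr (_ * (_ : bool)%:R + _ * (_ * (_ : bool)%:R)); exact: andbC.
split=> // a b.
- rewrite !ESS !mulrDl !mulrDr commSn -!addrA; congr (_ + _).
  rewrite !addrA; congr (_ + _); last first.
    rewrite -!mulrA ![E n _ * (x n * _)]mulrA !continuant_far // -!mulrA.
    by rewrite [E n _ * E n _]commn.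
  have := mixC (a - 1) (b - 1); rewrite /mix !subrK => mixE.
  by rewrite !mulrA addrC mixE addrC.
- rewrite /mix !continuant_near ![E n.+2 _]ESS !addrK.
  have rearr c d : x n.+1 * E n.+1 c * (E n.+1 (d + 1) + x n * E n d) +
    (x n.+1 * E n.+1 (c + 1) + q * x n.+1 * x n * E n c) * E n.+1 d =
    x n.+1 * (E n.+1 c * E n.+1 (d + 1) + E n.+1 (c + 1) * E n.+1 d)
     + x n.+1 * mixq n c d.
    by rewrite /mixq !(q_central (x n.+1)) !mulrDl !mulrDr !mulrA addrACA.
  rewrite !rearr mixqC; congr (x n.+1 * _ + _).
  by rewrite addrC commSn [X in _ + X]commSn.
rewrite /mixq !continuant_near ![E n.+2 _]ESS.
have rearr c d : (x n.+1 * E n.+1 c + q * x n.+1 * x n * E n (c - 1)) * E n.+1 d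
    + q * x n.+1 * E n.+1 c * (E n.+1 d + x n * E n (d - 1)) =
    (x n.+1 + q * x n.+1) * (E n.+1 c * E n.+1 d)
    + q * x n.+1 * mix n (c - 1) (d - 1).
  rewrite /mix !subrK !mulrDl !mulrDr !mulrA.
  rewrite -!addrA; congr (_ + _); rewrite addrCA; congr (_ + _).
by rewrite !rearr mixC commSn.
Qed.

End Continuants.

(* The generators g k only commute with each other; their double centralizer is
   a commutative subring, in which determinants can be formed. *)
Section DoubleCentralizer.

Variables (A : nzRingType) (I : Type) (g : I -> A).

Definition bicentralizer : {pred A} := fun x =>
  `[< forall y, (forall k, y * g k = g k * y) -> x * y = y * x >].

Fact bicentralizer_subring : subring_closed bicentralizer.
Proof.
split=> [|x y /asboolP xP /asboolP yP|x y /asboolP xP /asboolP yP];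
  apply/asboolP => z zP.
- by rewrite mul1r mulr1.
- by rewrite mulrBl mulrBr xP ?yP.
by rewrite -mulrA yP // !mulrA xP.
Qed.
HB.instance Definition _ :=
  GRing.isSubringClosed.Build A bicentralizer bicentralizer_subring.

Hypothesis g_comm : forall a b, g a * g b = g b * g a.

(** Mentioning [g_comm] makes the type carry the proof on which its commutative ring structure
    rests. *)
Definition cring : Type := let _ := g_comm in {x : A | x \in bicentralizer}.
HB.instance Definition _ := SubChoice.on cring.
HB.instance Definition _ := [SubChoice_isSubNzRing of cring by <:].

(** By [g_comm] each [g l] centralizes the generators, so [y] commutes with every [g l]; thus [y]
    centralizes the generators as well, and [x] commutes with it. *)
Fact cring_mulC : commutative (@GRing.mul cring).
Proof.
move=> x y; apply: val_inj => /=.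
have /asboolP := valP x; apply => k; have /asboolP := valP y; apply => l.
exact: g_comm.
Qed.
HB.instance Definition _ := GRing.PzRing_hasCommutativeMul.Build cring cring_mulC.

Fact cgen_subproof k : g k \in bicentralizer.
Proof. by apply/asboolP => y ->. Qed.

Definition cgen (k : I) : cring := exist _ (g k) (cgen_subproof k).

Definition cval : cring -> A := val.
HB.instance Definition _ := GRing.RMorphism.on cval.

Lemma cval_gen k : cval (cgen k) = g k.
Proof. by []. Qed.

Lemma cvalM x y : cval (x * y) = cval x * cval y.
Proof. by []. Qed.

Lemma cval_sign (b : bool) : cval ((-1) ^+ b) = (-1) ^+ b.
Proof. by case: b. Qed.

End DoubleCentralizer.

(** * The Pieri rule for determinants *)

(* The dual Jacobi-Trudi matrix, with the parts of la indexing the columns. *)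
Definition JT (C : Type) (g : int -> C) (L : nat) (la : 'I_L -> nat) : 'M[C]_L :=
  \matrix_(i < L, k < L) g ((la k)%:Z - k%:Z + i%:Z).

Lemma count_leq_iota m n : count (leq m) (iota 0 n) = (n - m)%N.
Proof.
elim: n => // n IHn; rewrite -addn1 iotaD count_cat IHn /= add0n addn0.
by case: leqP; lia.
Qed.

Lemma sorted_bool_ord (l n : nat) (e : 'I_(l + n) -> bool) :
  (\sum_i e i = n)%N ->
  (forall i j : 'I_(l + n), j = i.+1 :> nat -> e i -> e j) ->
  forall i : 'I_(l + n), e i = (l <= i)%N.
Proof.
move=> sum_e mono_e i.
have mono (j : 'I_(l + n)) : forall i : 'I_(l + n), (i <= j)%N -> e i -> e j.
  move: {2}(j : nat) (erefl (j : nat)) => m; elim: m j => [|m IHm] j jm i' ij ei'.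
    by have -> : j = i' by apply: val_inj => /=; lia.
  have [->//|ij'] := eqVneq j i'.
  have mlt : (m < l + n)%N by have := ltn_ord j; lia.
  apply: (mono_e (Ordinal mlt)) => //=.
  by apply: IHm ei' => //=; move: ij'; rewrite -val_eqE /=; lia.
have sum_le (P : pred nat) : (\sum_(i < l + n) (P i : nat) = count P (iota 0 (l + n)))%N.
  have -> : iota 0 (l + n) = index_iota 0 (l + n) by rewrite /index_iota subn0.
  by rewrite -sum1_count big_mkord [RHS]big_mkcond; apply: eq_bigr => j _; case: (P j).
case: leqP => li.
  apply/negPn/negP => nei.
  have : (\sum_i e i <= \sum_(j < l + n) (i.+1 <= j)%N)%N.
    apply: leq_sum => j _; case ej: (e j) => //=.
    by rewrite ltnNge; case: leqP => // /(mono _ _)/(_ ej); rewrite (negPf nei).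
  by rewrite sum_e (sum_le (leq i.+1)) count_leq_iota; have := ltn_ord i; lia.
apply/negP => ei.
have : (\sum_(j < l + n) (i <= j)%N <= \sum_i e i)%N.
  by apply: leq_sum => j _; case: (leqP i j) => // ij; rewrite (mono _ _ ij ei).
by rewrite sum_e (sum_le (leq i)) count_leq_iota; lia.
Qed.

Section Pieri.

Variables (C : comNzRingType) (g : int -> C).
Hypothesis g_neg : forall k, k < 0 -> g k = 0.
Hypothesis g0 : g 0 = 1.

Variables (l n : nat) (la : 'I_(l + n) -> nat).
Hypothesis la0 : forall k : 'I_(l + n), (l <= k)%N -> la k = 0%N.

Let shifted (e : {ffun 'I_(l + n) -> bool}) : 'M[C]_(l + n) :=
  \matrix_(i, k) g ((la k)%:Z - k%:Z + i%:Z + (e i : nat)%:Z).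

(* Permuting the shifts along with the columns moves them to the rows. *)
Lemma sum_column_shifts :
  \sum_(e : {ffun 'I_(l + n) -> bool} | (\sum_i e i == n)%N)
    \det (JT g (fun k => la k + e k)%N) =
  \sum_(e : {ffun 'I_(l + n) -> bool} | (\sum_i e i == n)%N) \det (shifted e).
Proof.
rewrite /determinant exchange_big [RHS]exchange_big /=; apply: eq_bigr => s _.
rewrite -!mulr_sumr; congr (_ * _).
pose h (s : 'S_(l + n)) (e : {ffun 'I_(l + n) -> bool}) := [ffun i => e (s i)].
have hK : cancel (h s^-1%g) (h s).
  by move=> e; apply/ffunP => i; rewrite !ffunE permK.
rewrite (reindex_inj (can_inj hK)) /=; apply: eq_big => e.
  congr (_ == _); rewrite [RHS](reindex_inj (@perm_inj _ s^-1%g)) /=.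
  by apply: eq_bigr => i _; rewrite ffunE.
move=> _; apply: eq_bigr => i _; rewrite !mxE ffunE permK.
by congr g; lia.
Qed.

(** A 1 at [i] followed by a 0 at [i + 1] makes rows [i] and [i + 1] equal. Without such a descent
    the ones fill the last [n] rows. *)
Lemma det_shifted_eq0 (e : {ffun 'I_(l + n) -> bool}) : (\sum_i e i == n)%N ->
  e != [ffun i : 'I_(l + n) => l <= i]%N -> \det (shifted e) = 0.
Proof.
move=> /eqP sum_e /eqP e_neq.
have [/existsP[i /existsP[j /and3P[/eqP ji ei nej]]]|no_desc] :=
  boolP [exists i : 'I_(l + n), [exists j : 'I_(l + n),
    [&& j == i.+1 :> nat, e i & ~~ e j]]].
  apply: (@determinant_alternate _ _ _ i j) => [|k].
    by rewrite -val_eqE /= ji neq_ltn ltnSn.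
  by rewrite !mxE ei (negPf nej) ji; congr g; lia.
case: e_neq; apply/ffunP => i; rewrite ffunE; apply: sorted_bool_ord => //.
move=> {}i j ji ei; apply/negPn/negP => nej; case/negP: no_desc.
by apply/existsP; exists i; apply/existsP; exists j; rewrite ji eqxx ei.
Qed.

(** The only surviving shift raises the last [n] rows. As the last [n] parts vanish, the matrices
    with and without this shift are block lower triangular with the same upper block; the shift
    changes the lower block from unitriangular to the matrix of the shape [1^n]. *)
Lemma Pieri :
  \det (JT g la) * \det (JT g (fun _ : 'I_n => 1%N)) =
  \sum_(e : {ffun 'I_(l + n) -> bool} | (\sum_i e i == n)%N)
    \det (JT g (fun k => la k + e k)%N).
Proof.
rewrite sum_column_shifts (bigD1 [ffun i : 'I_(l + n) => (l <= i)%N]) /=; last first.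
  rewrite big_split_ord /= big1 ?add0n => [|i _]; last by rewrite ffunE /= leqNgt ltn_ord.
  rewrite (eq_bigr (fun=> 1%N)) => [|i _]; last by rewrite ffunE /= leq_addr.
  by rewrite sum1_card card_ord.
rewrite [X in _ = _ + X]big1 ?addr0 => [|e /andP[e_sum e_neq]]; last first.
  exact: det_shifted_eq0.
pose B := ulsubmx (JT g la).
have -> : JT g la = block_mx B 0 (dlsubmx (JT g la)) (drsubmx (JT g la)).
  rewrite -[LHS]submxK; congr block_mx; apply/matrixP => i k; rewrite !mxE /=.
  by rewrite la0 ?leq_addr // g_neg //; have := ltn_ord i; lia.
have -> : shifted [ffun i : 'I_(l + n) => (l <= i)%N] =
    block_mx B 0 (dlsubmx (shifted [ffun i : 'I_(l + n) => (l <= i)%N]))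
      (JT g (fun _ : 'I_n => 1%N)).
  rewrite -[LHS]submxK; congr block_mx; apply/matrixP => i k;
    rewrite !mxE ffunE /=.
  - by rewrite leqNgt ltn_ord /= addr0.
  - rewrite la0 ?leq_addr // g_neg // leqNgt ltn_ord /=; have := ltn_ord i; lia.
  - by rewrite la0 ?leq_addr //; congr g; lia.
have det_dr : \det (drsubmx (JT g la)) = 1.
  rewrite det_trig ?big1 // => [i _|].
    by rewrite !mxE la0 ?leq_addr // [_ + _](_ : _ = 0) ?g0 //=; lia.
  apply/is_trig_mxP => i k ik.
  by rewrite !mxE la0 ?leq_addr // g_neg //=; lia.
by rewrite !det_lblock det_dr mulr1.
Qed.

End Pieri.

Lemma nonincreasing_ord (L : nat) (la : 'I_L -> nat) :
  (forall i j : 'I_L, j = i.+1 :> nat -> (la j <= la i)%N) ->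
  forall i j : 'I_L, (i <= j)%N -> (la j <= la i)%N.
Proof.
move=> la_dec i j; move: {2}(j : nat) (erefl (j : nat)) => m.
elim: m j => [|m IHm] j jm ij.
  by have -> : j = i by apply: val_inj => /=; lia.
have [->//|ij'] := eqVneq j i.
have mL : (m < L)%N by have := ltn_ord j; lia.
apply: leq_trans (la_dec (Ordinal mL) j jm) _.
by apply: IHm => //=; move: ij'; rewrite -val_eqE /=; lia.
Qed.

(** If adding [e] destroys the order at [i], then [la] has equal parts at [i] and [i + 1] and only
    the second one grows, so two columns coincide. The bound by [L] makes the last [n] parts 0, as
    [Pieri] requires. *)
Lemma Pieri_partitions (C : comNzRingType) (g : int -> C) (L n : nat)
    (la : 'I_L -> nat) :
  (forall k, k < 0 -> g k = 0) -> g 0 = 1 ->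
  (forall i j : 'I_L, j = i.+1 :> nat -> (la j <= la i)%N) ->
  (\sum_i la i + n <= L)%N ->
  \det (JT g la) * \det (JT g (fun _ : 'I_n => 1%N)) =
  \sum_(e : {ffun 'I_L -> bool} | (\sum_i e i == n)%N &&
      [forall i : 'I_L, forall j : 'I_L,
         (j == i.+1 :> nat) ==> (la j + e j <= la i + e i)%N])
    \det (JT g (fun k => la k + e k)%N).
Proof.
move=> g_neg g0 la_dec le_L.
transitivity (\sum_(e : {ffun 'I_L -> bool} | (\sum_i e i == n)%N)
    \det (JT g (fun k => la k + e k)%N)); last first.
  rewrite (bigID (fun e : {ffun 'I_L -> bool} => [forall i : 'I_L, forall j : 'I_L,
         (j == i.+1 :> nat) ==> (la j + e j <= la i + e i)%N])) /=.
  rewrite [X in _ + X]big1 ?addr0 // => e /andP[_].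
  rewrite negb_forall => /existsP[i]; rewrite negb_forall => /existsP[j].
  rewrite negb_imply => /andP[/eqP ji nle]; have ij := la_dec _ _ ji.
  rewrite -det_tr; apply: (@determinant_alternate _ _ _ i j) => [|k].
    by rewrite -val_eqE /= ji neq_ltn ltnSn.
  rewrite !mxE ji; congr g; move: nle; case: (e i); case: (e j) => /=; lia.
have [l E] : exists l, L = (l + n)%N by exists (L - n)%N; lia.
subst L; apply: Pieri => // k lk; apply/eqP; rewrite -leqn0 leqNgt; apply/negP => lak.
(* A positive part at position [k] forces [k + 1] positive parts, hence a sum larger than [l]. *)
have : (\sum_(i < l + n | (i <= k)%N) 1 <= \sum_(i < l + n | (i <= k)%N) la i)%N.
  by apply: leq_sum => i ik; apply: leq_trans (nonincreasing_ord la_dec ik).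
have : (\sum_(i < l + n | (i <= k)%N) la i <= \sum_i la i)%N.
  by rewrite [X in (_ <= X)%N](bigID (fun i : 'I_(l + n) => i <= k)%N) leq_addr.
have -> : (\sum_(i < l + n | (i <= k)%N) 1 = k.+1)%N.
  rewrite -[RHS]card_ord -sum1_card.
  by rewrite [RHS](big_ord_widen _ (fun=> 1%N) (ltn_ord k)).
lia.
Qed.

(** * Stacking dual Dyck rows *)

(* [stackable u v]: the row v may be placed right below the row u. *)
Fixpoint stackable (u v : seq int) {struct v} : bool :=
  match v, u with
  | [::], _ => true
  | _ :: _, [::] => false
  | y :: v', x :: u' => (x <= y + 1) && stackable u' v'
  end.

(** An entry of [v] below an empty cell of [u] counts as a flaw, as if the missing letter were
    infinite. *)
Definition stackable_upto (p : nat) (u v : seq int) : bool :=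
  stackable (take p u) (take p v).

Lemma stackable_size u v : stackable u v -> (size v <= size u)%N.
Proof. by elim: u v => [|x u IHu] [|y v] //= /andP[_ /IHu]. Qed.

Lemma stackableP u v : reflect
  ((size v <= size u)%N /\ forall p, (p < size v)%N -> u`_p <= v`_p + 1)
  (stackable u v).
Proof.
elim: v u => [|y v IHu] [|x u] /=.
- by constructor.
- by constructor.
- by constructor; case.
apply: (iffP andP) => [[xy /IHu[le_vu uv]]|[le_vu uv]].
  by split=> // -[|p] //= /uv.
split; first by have := uv 0%N isT.
by apply/IHu; split=> // p pv; have := uv p.+1 pv.
Qed.

Lemma stackable_cat u u' v v' : size u = size v ->
  stackable (u ++ u') (v ++ v') = stackable u v && stackable u' v'.
Proof. by elim: u v => [|x u IHu] [|y v] //= /eqP; rewrite eqSS => /eqP/IHu->; rewrite andbA. Qed.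

Lemma stackable_take u v n : (size v <= n)%N -> stackable (take n u) v = stackable u v.
Proof.
by elim: v u n => [|y v IHv] [|x u] [|n] //= vn; rewrite IHv.
Qed.

Lemma stackable_upto_takel p u v : stackable_upto p (take p u) v = stackable_upto p u v.
Proof. by rewrite /stackable_upto take_takel. Qed.

Lemma stackable_upto_taker p u v : stackable_upto p u (take p v) = stackable_upto p u v.
Proof. by rewrite /stackable_upto take_takel. Qed.

Lemma stackable_upto0 u v : stackable_upto 0 u v.
Proof. by rewrite /stackable_upto !take0. Qed.

Lemma stackable_uptoS p u v : stackable_upto p.+1 u v -> stackable_upto p u v.
Proof.
rewrite /stackable_upto; elim: p u v => [|p IHp] u v; first by rewrite !take0.
by case: u v => [|x u] [|y v] //= /andP[-> /IHp].
Qed.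

Lemma stackable_upto_large p u v : (size v <= p)%N -> stackable_upto p u v = stackable u v.
Proof. by move=> vp; rewrite /stackable_upto (take_oversize vp) stackable_take. Qed.

Lemma dual_dyck_cons (x : int) (w : seq int) :
  dual_dyck (x :: w) = dual_dyck w && all (>= (x + 2)) w.
Proof.
elim: w x => [|y w IHw] x //.
have -> : dual_dyck (x :: y :: w) = (x + 2 <= y) && dual_dyck (y :: w) by [].
rewrite !IHw [all _ (y :: w)]/=.
case: (dual_dyck w) => /=; last by rewrite andbF.
have [xy|] := boolP (x + 2 <= y) => //=; last by rewrite andbF.
have [yw|//] := boolP (all _ w); apply/esym/allP => z /(allP yw) /=.
by move=> ?; lia.
Qed.

Lemma dual_dyckE w : dual_dyck w = pairwise (fun a b : int => a + 2 <= b) w.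
Proof. by apply: sorted_pairwise => y x z /=; lia. Qed.

Lemma dual_dyck_cat s t : dual_dyck (s ++ t) =
  [&& allrel (fun a b : int => a + 2 <= b) s t, dual_dyck s & dual_dyck t].
Proof. by rewrite !dual_dyckE pairwise_cat. Qed.

Lemma dual_dyck_rcons s y : dual_dyck (rcons s y) =
  all (<= (y - 2)) s && dual_dyck s.
Proof.
rewrite -cats1 dual_dyck_cat allrel1r andbT; congr (_ && _).
by apply: eq_all => x /=; lia.
Qed.

(* Two dual Dyck rows have their first flaw in column p, at the letter y of
   the lower row, exactly when both tails consist of letters >= y + 2; the two
   tails are then interchangeable. *)
Lemma first_flawE p u0 v1 y U V : size u0 = p -> size v1 = p ->
  [&& dual_dyck (rcons v1 y ++ V), dual_dyck (u0 ++ U),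
      stackable_upto p (u0 ++ U) (rcons v1 y ++ V)
    & ~~ stackable_upto p.+1 (u0 ++ U) (rcons v1 y ++ V)] =
  [&& dual_dyck (rcons v1 y), dual_dyck u0, stackable u0 v1,
      dual_dyck V && all (>= (y + 2)) V & dual_dyck U && all (>= (y + 2)) U].
Proof.
move=> su sv.
have -> : stackable_upto p (u0 ++ U) (rcons v1 y ++ V) = stackable u0 v1.
  by rewrite /stackable_upto take_size_cat // cat_rcons take_size_cat.
have -> : stackable_upto p.+1 (u0 ++ U) (rcons v1 y ++ V) = stackable u0 v1 && stackable (take 1 U) [:: y].
  rewrite /stackable_upto [take _ (rcons _ _ ++ _)]take_size_cat ?size_rcons ?sv //.
  by rewrite take_cat su ltnNge leqnSn /= subSnn -cats1 stackable_cat // su.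
rewrite dual_dyck_cat [dual_dyck (u0 ++ U)]dual_dyck_cat.
case duv: (stackable u0 v1) => /=; last by rewrite !andbF.
case dv: (dual_dyck (rcons v1 y)); last by rewrite !(andbF, andFb).
case du: (dual_dyck u0); last by rewrite !(andbF, andFb).
have vy : all (<= (y - 2)) v1 by move: dv; rewrite dual_dyck_rcons => /andP[].
(* [u_i <= v_i + 1 <= y - 1], so every dual Dyck tail with letters [>= y + 2] may follow [u0]. *)
have uy : all (<= (y - 1)) u0.
  have /stackableP[_ uv] := duv.
  apply/allP => x /(nthP 0)[i iu <-]; rewrite su -sv in iu.
  have /(allP vy) /= := mem_nth 0 iu; have := uv i iu.
  by move: (nth 0 u0 i) (nth 0 v1 i) => a b; lia.
rewrite !andTb; have [dV|] := boolP (dual_dyck V); last by rewrite !andbF.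
have [dU|] := boolP (dual_dyck U); last by rewrite !(andbF, andFb).
rewrite !(andbT, andTb).
have -> : allrel (fun a b : int => a + 2 <= b) (rcons v1 y) V = all (>= (y + 2)) V.
  rewrite -cats1 allrel_catl allrel1l; apply/andb_idl => /allP yV.
  by apply/allrelP => a b /(allP vy) /= ay /yV /=; lia.
case: (all _ V); rewrite ?andbF //=.
(* If [U] is empty, the upper row ends before column [p], and the letter [y] is a flaw by itself. *)
case: U dU => [|x U] dU /=; first by rewrite allrel0r.
rewrite andbT -ltNge; apply/andP/andP => -[].
  move=> _ yx; split; first by lia.
  have := dU; rewrite dual_dyck_cons => /andP[_ /allP xU].
  by apply/allP => z /xU /=; lia.
move=> yx /allP yU; split; last by lia.
apply/allrelP => a b /(allP uy) /= ay; rewrite inE => /orP[/eqP->|/yU /=]; lia.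
Qed.

(** * Words in q-commuting letters *)

Section Alphabet.

Variables (A : nzRingType) (q : A) (wd : seq int -> A).
Hypothesis q_central : forall y, q * y = y * q.
Hypothesis wd_nil : wd [::] = 1.
Hypothesis wd_cat : forall s t, wd (s ++ t) = wd s * wd t.
Hypothesis wd_letters_comm : forall x y : int,
  y != x - 1 -> x != y - 1 -> wd [:: x] * wd [:: y] = wd [:: y] * wd [:: x].
Hypothesis wd_near : forall x : int,
  wd [:: x + 1] * wd [:: x] = q * wd [:: x] * wd [:: x + 1].

Lemma wd_cons (x : int) (w : seq int) : wd (x :: w) = wd [:: x] * wd w.
Proof. by rewrite -wd_cat. Qed.

Lemma wd_comm (s t : seq int) :
  {in s & t, forall x y, (y != x - 1) && (x != y - 1)} ->
  wd s * wd t = wd t * wd s.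
Proof.
elim: s => [|x s IHs] st; first by rewrite wd_nil mulr1 mul1r.
have st' : {in s & t, forall a b, (b != a - 1) && (a != b - 1)}.
  move=> a b sa tb.
  have xsa : a \in x :: s by rewrite inE sa orbT.
  exact: st a b xsa tb.
rewrite wd_cons -mulrA (IHs st').
have {}st : {in t, forall y, (y != x - 1) && (x != y - 1)}.
  by move=> y ty; exact: st x y (mem_head _ _) ty.
rewrite !mulrA; congr (_ * wd s).
elim: t st {IHs st'} => [|y t IHt] xt; first by rewrite wd_nil mulr1 mul1r.
have /andP[xy yx] := xt y (mem_head _ _).
rewrite (wd_cons y t) mulrA (wd_letters_comm xy yx) -!mulrA IHt // => z tz.
by have := xt z; rewrite inE tz orbT; apply.
Qed.
Variable letters : seq int.
Hypothesis letters_uniq : uniq letters.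

Fixpoint words (n : nat) : seq (seq int) :=
  if n is n'.+1 then [seq x :: w | x <- letters, w <- words n'] else [:: [::]].

(** The row lengths in the determinant may be negative; no word has such a length, so the sums
    vanish there. *)
Definition wordsZ (k : int) : seq (seq int) :=
  if k is Posz n then words n else [::].

Lemma mem_words n w : (w \in words n) = (size w == n) && all [in letters] w.
Proof.
elim: n w => [|n IHn] w /=; first by rewrite inE; case: w.
apply/allpairsP/idP => [[[x w'] /= [xl + ->]]|].
  by rewrite IHn /= eqSS xl => /andP[-> ->].
case: w => [|x w] //=; rewrite eqSS => /and3P[sw xl wl].
by exists (x, w); rewrite IHn sw wl xl.
Qed.

Lemma words_uniq n : uniq (words n).
Proof.
elim: n => //= n IHn; apply: allpairs_uniq => //.
by move=> [x v] [y w] _ _ /= [-> ->].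
Qed.

Lemma big_wordsS (R : nmodType) n (F : seq int -> R) :
  \sum_(w <- words n.+1) F w = \sum_(x <- letters) \sum_(w <- words n) F (x :: w).
Proof. by rewrite /= big_allpairs_dep. Qed.

Lemma big_words_cat (R : nmodType) m n (F : seq int -> R) :
  \sum_(w <- words (m + n)) F w =
  \sum_(u <- words m) \sum_(v <- words n) F (u ++ v).
Proof.
elim: m F => [|m IHm] F; first by rewrite add0n big_seq1.
rewrite addSn !big_wordsS; apply: eq_bigr => x _.
by rewrite IHm.
Qed.

Definition gen_from (c k : int) : A :=
  \sum_(w <- wordsZ k | dual_dyck w && all (>= c) w) wd w.

Lemma gen_from0 c : gen_from c 0 = 1.
Proof. by rewrite /gen_from big_mkcond big_seq1 /= wd_nil. Qed.

Lemma gen_fromS c (n : nat) :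
  gen_from c n.+1 = \sum_(x <- letters | c <= x) wd [:: x] * gen_from (x + 2) n.
Proof.
rewrite /gen_from /= big_mkcond big_allpairs_dep [RHS]big_mkcond /=.
apply: eq_bigr => x _; case: ifP => cx; last first.
  by rewrite big1 // => w _; rewrite andbF.
rewrite mulr_sumr [RHS]big_mkcond /=; apply: eq_bigr => w _.
rewrite -[path _ x w]/(dual_dyck (x :: w)) dual_dyck_cons /= -wd_cons.
case: (dual_dyck w) => //=.
have [xw|//] := boolP (all (>= (x + 2)) w) => /=.
by have -> // : all (>= c) w by apply/allP => z /(allP xw) /= ?; lia.
Qed.

(** Letters missing from the alphabet become 0, so that the recursion and the commutation relations
    hold over all consecutive integers. *)
Definition lwd (c : int) : A := if c \in letters then wd [:: c] else 0.

Lemma gen_from_rec c k : gen_from c k = gen_from (c + 1) k + lwd c * gen_from (c + 2) (k - 1).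
Proof.
case: k => [[|n]|n]; last by rewrite /gen_from !big_nil mulr0 addr0.
  by rewrite !gen_from0 /gen_from /= big_nil mulr0 addr0.
have -> : n.+1%:Z - 1 = n by lia.
rewrite !gen_fromS (bigID (pred1 c)) /= addrC; congr (_ + _).
  by apply: eq_bigl => x; lia.
rewrite (eq_bigl (pred1 c)) => [|x /=]; last by lia.
rewrite /lwd; case: ifPn => cl; first by rewrite -big_filter filter_pred1_uniq ?big_seq1.
rewrite mul0r big1_seq // => x /andP[/eqP-> cl'].
by rewrite cl' in cl.
Qed.

Lemma gen_from_large c k : all (< c) letters -> gen_from c k = (k == 0)%:R.
Proof.
move=> cl; case: k => [[|n]|n]; first by rewrite gen_from0.
  rewrite gen_fromS big1_seq // => x /andP[cx /(allP cl)] /=.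
  by rewrite ltNge cx.
by rewrite /gen_from big_nil.
Qed.

Lemma lwd_comm x y :
  y != x - 1 -> x != y - 1 -> lwd x * lwd y = lwd y * lwd x.
Proof.
rewrite /lwd; case: ifP => _; case: ifP => _; rewrite ?mul0r ?mulr0 //.
exact: wd_letters_comm.
Qed.

Lemma lwd_near x : lwd (x + 1) * lwd x = q * lwd x * lwd (x + 1).
Proof.
rewrite /lwd; case: ifP => _; case: ifP => _; by rewrite ?(mul0r, mulr0).
Qed.

Lemma letters_bound : exists B : int, all (fun x => - B < x < B) letters.
Proof.
elim: letters => [|x l [B IH]]; first by exists 0.
exists (`|B| + `|x| + 1)%:Z; rewrite /= ; apply/andP; split; first by lia.
by apply: sub_all IH => y /=; lia.
Qed.

Lemma gen_from_comm c a b : gen_from c a * gen_from c b = gen_from c b * gen_from c a.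
Proof.
have [B0 B0l] := letters_bound.
(* Levels are counted downwards from [B], which exceeds [c] and leaves no letter [>= B - 1], so that
   levels 0 and 1 are both trivial. Level [n] has lower bound [B - n], and [x n] is the letter
   [B - n - 2] that separates level [n + 2] from level [n + 1]. *)
pose B := (`|B0| + `|c| + 1)%:Z.
have Bl : all (< (B - 1)) letters by apply: sub_all B0l => x /=; rewrite /B; lia.
pose n := `|B - c|%N.
have -> : c = B - n%:Z by rewrite /B /n; lia.
apply: (@continuant_comm _ q (fun n => lwd (B - n%:Z - 2))
          (fun n k => gen_from (B - n%:Z) k)) => {a b n}.
- exact: q_central.
- by move=> m n mn; apply: lwd_comm; lia.
- move=> n; have -> : B - n%:Z - 2 = B - n.+1%:Z - 2 + 1 by lia.
  exact: lwd_near.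
- by move=> k; rewrite gen_from_large //; apply: sub_all Bl => x /=; lia.
- by move=> k; rewrite gen_from_large //; apply: sub_all Bl => x /=; lia.
move=> n k; rewrite gen_from_rec.
have -> : B - n.+2%:Z + 1 = B - n.+1%:Z by lia.
have -> : B - n.+2%:Z = B - n%:Z - 2 by lia.
by rewrite subrK.
Qed.

Definition gen (k : int) : A := \sum_(w <- wordsZ k | dual_dyck w) wd w.

Lemma gen_neg n : gen (Negz n) = 0.
Proof. by rewrite /gen big_nil. Qed.

Lemma gen0 : gen 0 = 1.
Proof. by rewrite /gen big_mkcond big_seq1 /= wd_nil. Qed.

Lemma gen_comm a b : gen a * gen b = gen b * gen a.
Proof.
have [B Bl] := letters_bound.
have genE k : gen k = gen_from (- B) k.
  rewrite /gen /gen_from big_seq_cond [RHS]big_seq_cond; apply: eq_bigl => w.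
  case: k => [n|//] /=; rewrite mem_words.
  have [/allP wl|] := boolP (all [in letters] w); last by rewrite andbF.
  have -> : all (>= (- B)) w; last by rewrite !andbT.
  by apply/allP => x /wl /(allP Bl) /=; lia.
by rewrite !genE gen_from_comm.
Qed.

Lemma wordsZ_size k w : w \in wordsZ k -> k = (size w)%:Z.
Proof. by case: k => [n|//]; rewrite mem_words => /andP[/eqP->]. Qed.

Lemma gen_from_neg c k : k < 0 -> gen_from c k = 0.
Proof. by case: k => // n _; rewrite /gen_from big_nil. Qed.

(* The first-flaw pairs (v below u) of columns p, with the prefixes take p.+1 v
   and take p u constrained by arbitrary predicates. *)
Definition flawed_pairs (p : nat) (cv cu : pred (seq int)) (a b : int) : A :=
  \sum_(v <- wordsZ b) \sum_(u <- wordsZ a)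
    if [&& cv (take p.+1 v), cu (take p u), dual_dyck v, dual_dyck u, stackable_upto p u v
         & ~~ stackable_upto p.+1 u v]
    then wd v * wd u else 0.

(** Matches, on the side of the rows, the vanishing of [gen_from] in negative degree: a first flaw
    in column [p] needs [p + 1] letters in [v] and [p] in [u]. *)
Lemma no_flaw (p : nat) (u v : seq int) :
  (size v <= p)%N || (size u < p)%N -> stackable_upto p u v -> stackable_upto p.+1 u v.
Proof.
case: (leqP (size v) p) => [vp _|pv /= up].
  by rewrite !stackable_upto_large // leqW.
rewrite /stackable_upto => /stackable_size; rewrite (size_takel (ltnW pv)).
by rewrite take_oversize ?(ltnW up) // leqNgt up.
Qed.

(** With [v = v0 V] and [u = u0 U], the reading word contains [v0 V u0 U]. The letters of [u0] are
    at most [y - 1] and those of [V] at least [y + 2], where [y] ends [v0]; so [V] and [u0] commute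
    without a power of [q], and both tails come together at the end. *)
Lemma flawed_pairsE p cv cu a b :
  flawed_pairs p cv cu a b =
  \sum_(v0 <- words p.+1) \sum_(u0 <- words p)
    (if [&& cv v0, cu u0, dual_dyck v0, dual_dyck u0 & stackable u0 (take p v0)]
     then wd v0 * wd u0 else 0)
    * (gen_from (last 0 v0 + 2) (b - p.+1%:Z) * gen_from (last 0 v0 + 2) (a - p%:Z)).
Proof.
have [[b' bE]|bp] : (exists b', b = (p.+1 + b')%N) \/ (b < p.+1).
  have [|pb] := ltP b p.+1; [by right|left].
  by exists (`|b| - p.+1)%N; lia.
have [[a' aE]|ap] : (exists a', a = (p + a')%N) \/ (a < p).
  have [|pa] := ltP a p; [by right|left].
  by exists (`|a| - p)%N; lia.
- rewrite /flawed_pairs aE bE -[wordsZ (p + a')%N]/(words (p + a')).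
  rewrite -[wordsZ (p.+1 + b')%N]/(words (p.+1 + b')) big_words_cat.
  rewrite big_seq [RHS]big_seq.
  apply: eq_bigr => v0; rewrite mem_words => /andP[/eqP sv _].
  have -> : (p.+1 + b')%N%:Z - p.+1%:Z = b' by lia.
  have -> : (p + a')%N%:Z - p%:Z = a' by lia.
  case: (lastP v0) sv => [//|v1 y]; rewrite size_rcons => -[sv].
  rewrite last_rcons -cats1 take_size_cat // cats1.
  have vy : all (<= (y - 2)) v1 || ~~ dual_dyck (rcons v1 y).
    by rewrite dual_dyck_rcons; case: (all _ v1) => //=.
  under eq_bigr do rewrite big_words_cat.
  rewrite exchange_big /= big_seq [RHS]big_seq; apply: eq_bigr => u0.
  rewrite mem_words => /andP[/eqP su _].
  rewrite /gen_from /= [X in _ = _ * (X * _)]big_mkcond [X in _ = _ * (_ * X)]big_mkcond.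
  rewrite big_distrlr mulr_sumr.
  apply: eq_bigr => V _; rewrite mulr_sumr; apply: eq_bigr => U _ /=.
  have -> : take p.+1 (rcons v1 y ++ V) = rcons v1 y.
    by rewrite take_size_cat // size_rcons sv.
  have -> : take p (u0 ++ U) = u0 by rewrite take_size_cat.
  rewrite first_flawE //.
  case cvv: (cv _); rewrite /= ?mul0r //; case cuu: (cu _); rewrite /= ?mul0r //.
  case dv: (dual_dyck (rcons v1 y)) vy; rewrite /= ?mul0r // orbF => vy.
  case du: (dual_dyck u0); rewrite /= ?mul0r //.
  case uv: (stackable u0 v1); rewrite /= ?mul0r //.
  case VV: (dual_dyck V && _); case: (dual_dyck U && _); rewrite ?mulr0 ?mul0r ?mulr0 //.
  have /andP[_ yV] := VV.
  rewrite !wd_cat !mulrA; congr (_ * _); rewrite -!mulrA; congr (_ * _).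
  apply: wd_comm => x1 y1 /(allP yV) /= aV bu.
  have /stackableP[_ {}uv] := uv.
  have /(nthP 0)[i iu y1E] := bu.
  have := uv i; rewrite sv -su => /(_ iu).
  have /(allP vy) /= : nth 0 v1 i \in v1 by rewrite mem_nth // sv -su.
  rewrite -{}y1E {bu y1}; move: (nth 0 u0 i) (nth 0 v1 i) aV => y1 c; lia.
- rewrite /flawed_pairs big1 => [|v _].
    rewrite big1 // => v0 _; rewrite big1 // => u0 _.
    by rewrite (gen_from_neg _ (k := a - p%:Z)) ?mulr0 ?subr_lt0.
  rewrite big_seq big1 // => u /wordsZ_size uE.
  case: ifP => // /and5P[_ _ _ _] /andP[uv].
  by rewrite (no_flaw _ uv) // -[(size u < p)%N]ltz_nat -uE ap orbT.
rewrite /flawed_pairs big_seq big1 => [|v /wordsZ_size vE].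
  rewrite big1 // => v0 _; rewrite big1 // => u0 _.
  by rewrite (gen_from_neg _ (k := b - p.+1%:Z)) ?mul0r ?mulr0 ?subr_lt0.
rewrite big1 // => u _.
case: ifP => // /and5P[_ _ _ _] /andP[uv].
by rewrite (no_flaw _ uv) // -ltnS -ltz_nat -vE bp.
Qed.

(** The prefixes have lengths [p] and [p + 1], so exchanging the tails turns the lengths [a], [b]
    into [b - 1], [a + 1]. This is also what composing the permutation with an adjacent
    transposition does to the lengths in the determinant. *)
Lemma flawed_pairs_swap p cv cu a b :
  flawed_pairs p cv cu a b = flawed_pairs p cv cu (b - 1) (a + 1).
Proof.
rewrite !flawed_pairsE; apply: eq_bigr => v _; apply: eq_bigr => u _.
congr (_ * _); have -> : a + 1 - p.+1%:Z = a - p%:Z by lia.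
have -> : b - 1 - p%:Z = b - p.+1%:Z by lia.
exact: gen_from_comm.
Qed.

(** * Cancellation of flawed arrays *)

Fixpoint arrays (nu : seq int) : seq (seq (seq int)) :=
  if nu is k :: nu' then [seq r :: P | r <- wordsZ k, P <- arrays nu'] else [:: [::]].

Lemma arrays_shape nu P : P \in arrays nu -> nu = [seq (size r)%:Z | r <- P].
Proof.
elim: nu P => [|k nu IHnu] P /=; first by rewrite inE => /eqP->.
by case/allpairsP => -[r Q] /= [/wordsZ_size-> /IHnu-> ->].
Qed.

Lemma big_arrays_cons (R : nmodType) k nu (F : seq (seq int) -> R) :
  \sum_(P <- arrays (k :: nu)) F P =
  \sum_(r <- wordsZ k) \sum_(P <- arrays nu) F (r :: P).
Proof. by rewrite /= big_allpairs_dep. Qed.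

Lemma big_arrays_cat (R : nmodType) nu1 nu2 (F : seq (seq int) -> R) :
  \sum_(P <- arrays (nu1 ++ nu2)) F P =
  \sum_(P1 <- arrays nu1) \sum_(P2 <- arrays nu2) F (P1 ++ P2).
Proof.
elim: nu1 F => [|k nu1 IH] F; first by rewrite big_seq1.
rewrite cat_cons !big_arrays_cons; apply: eq_bigr => r _; exact: IH.
Qed.

Definition array_sum (c : pred (seq (seq int))) (nu : seq int) : A :=
  \sum_(P <- arrays nu | all dual_dyck P && c P) wd (RR P).

Lemma RR_cons r P : RR (r :: P) = RR P ++ r.
Proof. by rewrite /RR rev_cons -cats1 flatten_cat /= cats0. Qed.

Lemma RR_cat P Q : RR (P ++ Q) = RR Q ++ RR P.
Proof. by rewrite /RR rev_cat flatten_cat. Qed.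

(* No flaw in the columns < p, and none in column p among the rows j, j + 1, and
   so on: flawed arrays are removed one pair of adjacent rows at a time, from
   the bottom row up and then column by column. *)
Definition mixed (p j : nat) (P : seq (seq int)) : bool :=
  sorted (stackable_upto p) (take j.+1 P) && sorted (stackable_upto p.+1) (drop j P).

Lemma sorted_upto_rcons p P u :
  sorted (stackable_upto p) (rcons P (take p u)) = sorted (stackable_upto p) (rcons P u).
Proof.
case: P => [|r P] //=; elim: P r => [|r' P IHP] r /=; last by rewrite IHP.
by rewrite stackable_upto_taker.
Qed.

Lemma sorted_upto_cons p P v :
  sorted (stackable_upto p) (take p v :: P) = sorted (stackable_upto p) (v :: P).
Proof. by case: P => [|r P] //=; rewrite stackable_upto_takel. Qed.

Lemma mixedS p P1 u v P2 :
  (mixed p (size P1) (P1 ++ u :: v :: P2) =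
     [&& sorted (stackable_upto p) (rcons P1 u), stackable_upto p.+1 u v & sorted (stackable_upto p.+1) (v :: P2)])
  * (mixed p (size P1).+1 (P1 ++ u :: v :: P2) =
     [&& sorted (stackable_upto p) (rcons P1 u), stackable_upto p u v & sorted (stackable_upto p.+1) (v :: P2)]).
Proof.
rewrite /mixed -cat_rcons -(size_rcons P1 u); split.
  rewrite take_size_cat // cat_rcons drop_size_cat //.
rewrite -cat_rcons -(size_rcons (rcons P1 u) v) take_size_cat //.
rewrite cat_rcons drop_size_cat //.
have -> : sorted (stackable_upto p) (rcons (rcons P1 u) v) =
    sorted (stackable_upto p) (rcons P1 u) && stackable_upto p u v.
  by case: P1 => [|r P1] /=; rewrite ?andbT // rcons_path last_rcons.
by rewrite andbA.
Qed.

(** The rows above see only the first [p] columns of [u], and the rows below only the first [p + 1]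
    of [v]. So the conditions on the other rows constrain the prefixes and leave the two tails
    free. *)
Lemma array_sum_flaw p nu1 a b nu2 :
  array_sum (fun P => mixed p (size nu1).+1 P && ~~ mixed p (size nu1) P)
    (nu1 ++ a :: b :: nu2) =
  \sum_(P1 <- arrays nu1 | all dual_dyck P1) \sum_(P2 <- arrays nu2 | all dual_dyck P2)
    wd (RR P2) *
    flawed_pairs p (fun v => sorted (stackable_upto p.+1) (v :: P2))
                   (fun u => sorted (stackable_upto p) (rcons P1 u)) a b
    * wd (RR P1).
Proof.
rewrite /array_sum big_mkcond big_arrays_cat big_seq [RHS]big_mkcond [RHS]big_seq.
apply: eq_bigr => P1 /arrays_shape nu1E.
have s1 : size nu1 = size P1 by rewrite nu1E size_map.
rewrite big_arrays_cons; under eq_bigr do rewrite big_arrays_cons.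
under eq_bigr do rewrite exchange_big.
rewrite exchange_big /=.
case d1: (all dual_dyck P1); last first.
  rewrite big1 // => P2 _; rewrite big1 // => u _; rewrite big1 // => v _.
  by rewrite all_cat d1.
rewrite [RHS]big_mkcond; apply: eq_bigr => P2 _.
case d2: (all dual_dyck P2); last first.
  rewrite big1 // => u _; rewrite big1 // => v _.
  by rewrite all_cat /= d2 !andbF.
rewrite /flawed_pairs mulr_sumr mulr_suml exchange_big; apply: eq_bigr => v _.
rewrite mulr_sumr mulr_suml; apply: eq_bigr => u _.
have -> : all dual_dyck (P1 ++ u :: v :: P2) = dual_dyck u && dual_dyck v.
  by rewrite all_cat /= d1 d2 andbT.
cbv beta; rewrite s1 !mixedS sorted_upto_rcons.
rewrite -[path _ _ _]/(sorted (stackable_upto p.+1) (take p.+1 v :: P2)) sorted_upto_cons.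
case: (sorted _ (rcons _ _)); rewrite ?andbF ?mulr0 ?mul0r //.
case: (sorted _ (v :: P2)); rewrite ?andbF ?mulr0 ?mul0r //.
rewrite !andbT !andTb.
case: (dual_dyck u); case: (dual_dyck v); rewrite /= ?mulr0 ?mul0r //.
case: ifP => _; rewrite /= ?mulr0 ?mul0r //.
by rewrite RR_cat !RR_cons !wd_cat !mulrA.
Qed.

Lemma array_sum_flaw_swap p nu1 a b nu2 :
  array_sum (fun P => mixed p (size nu1).+1 P && ~~ mixed p (size nu1) P)
    (nu1 ++ a :: b :: nu2) =
  array_sum (fun P => mixed p (size nu1).+1 P && ~~ mixed p (size nu1) P)
    (nu1 ++ (b - 1) :: (a + 1) :: nu2).
Proof.
rewrite !array_sum_flaw; apply: eq_bigr => P1 _; apply: eq_bigr => P2 _.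
by rewrite flawed_pairs_swap.
Qed.

Lemma eq_array_sum c c' nu : (forall P, P \in arrays nu -> c P = c' P) ->
  array_sum c nu = array_sum c' nu.
Proof.
move=> cc'; rewrite /array_sum big_seq_cond [RHS]big_seq_cond.
by apply: eq_bigl => P; case Pn: (P \in _) => //=; rewrite cc'.
Qed.

Lemma array_sumB p j nu : (j.+1 < size nu)%N ->
  array_sum (mixed p j.+1) nu = array_sum (mixed p j) nu +
    array_sum (fun P => mixed p j.+1 P && ~~ mixed p j P) nu.
Proof.
move=> jn; rewrite /array_sum (bigID (mixed p j)) /=; congr (_ + _); last first.
  by apply: eq_bigl => P; rewrite andbA.
rewrite big_seq_cond [RHS]big_seq_cond; apply: eq_bigl => P.
case Pn: (P \in _) => //=; rewrite -andbA; congr (_ && _).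
apply/andb_idl; have := arrays_shape Pn => nuE.
have sP : size nu = size P by rewrite nuE size_map.
rewrite sP in jn.
have sj : size (take j P) = j by rewrite size_takel // ltnW // ltnW.
have PE : P = take j P ++ nth [::] P j :: nth [::] P j.+1 :: drop j.+2 P.
  by rewrite -!drop_nth ?cat_take_drop // ltnW.
rewrite PE -[in mixed p j]sj -[in mixed p j.+1]sj !mixedS.
by case/and3P => -> /stackable_uptoS-> ->.
Qed.

(** * The Jacobi-Trudi formula *)

Definition symring : comNzRingType := cring gen_comm.
Definition sgen (k : int) : symring := cgen gen_comm k.

Lemma cval_prod (nu : seq int) :
  cval (\prod_(k <- nu) sgen k) = array_sum xpredT nu.
Proof.
elim: nu => [|k nu IHnu].
  by rewrite big_nil rmorph1 /array_sum big_mkcond big_seq1 /= wd_nil.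
rewrite big_cons mulrC cvalM IHnu cval_gen /array_sum [RHS]big_mkcond.
rewrite big_arrays_cons exchange_big /gen /= big_mkcond mulr_suml.
apply: eq_bigr => P _; case: ifP => Pd; last first.
  by rewrite mul0r big1 // => r _; rewrite andbT -[all _ _]andbT Pd andbF.
rewrite mulr_sumr big_mkcond; apply: eq_bigr => r _.
rewrite -andbA Pd andbT; case: ifP => //.
by rewrite RR_cons wd_cat.
Qed.

Section JacobiTrudi.

Variables (L : nat) (la : 'I_L -> nat).

Definition array_lengths (s : 'S_L) : seq int :=
  [seq (la (s i))%:Z - (s i)%:Z + (i : nat)%:Z | i <- enum 'I_L].

Definition alt_sum (c : pred (seq (seq int))) : A :=
  \sum_(s : 'S_L) (-1) ^+ s * array_sum c (array_lengths s).

Lemma cval_JT : cval (\det (JT sgen la)) = alt_sum xpredT.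
Proof.
rewrite /determinant raddf_sum; apply: eq_bigr => s _ /=.
rewrite cvalM cval_sign -cval_prod big_map big_enum /=; congr (_ * cval _).
by apply: eq_bigr => i _; rewrite mxE.
Qed.

Lemma size_array_lengths s : size (array_lengths s) = L.
Proof. by rewrite size_map size_enum_ord. Qed.

Lemma eq_alt_sum c c' : (forall P, size P = L -> c P = c' P) ->
  alt_sum c = alt_sum c'.
Proof.
move=> cc'; apply: eq_bigr => s _; congr (_ * _); apply: eq_array_sum => P /arrays_shape.
by move=> /(congr1 size); rewrite size_array_lengths size_map => /esym/cc'.
Qed.

(** Composing [s] with the transposition of [j] and [j + 1] preserves the sum of the arrays whose
    rows [j], [j + 1] are flawed in column [p], and reverses the sign; the even and odd permutations
    cancel. *)
Lemma alt_sum_mixed p j : (j.+1 < L)%N -> alt_sum (mixed p j.+1) = alt_sum (mixed p j).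
Proof.
move=> jL; pose j0 := Ordinal (ltnW jL); pose j1 := Ordinal jL.
pose D s := array_sum (fun P => mixed p j.+1 P && ~~ mixed p j P) (array_lengths s).
have DE s : D (tperm j0 j1 * s)%g = D s.
  pose s1 := take j (enum 'I_L); pose s2 := drop j.+2 (enum 'I_L).
  have enumE : enum 'I_L = s1 ++ j0 :: j1 :: s2.
    have n0 : nth j0 (enum 'I_L) j = j0 by apply: val_inj; rewrite /= nth_enum_ord // ltnW.
    have n1 : nth j0 (enum 'I_L) j.+1 = j1 by apply: val_inj; rewrite /= nth_enum_ord.
    by rewrite -[in RHS]n0 -n1 -!drop_nth ?cat_take_drop // size_enum_ord // ltnW.
  have ss1 : size s1 = j by rewrite size_takel // size_enum_ord ltnW // ltnW.
  have := enum_uniq 'I_L; rewrite enumE cat_uniq /= !inE !negb_or.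
  case/and5P => _ /and3P[j0s1 j1s1 s12] /andP[_ j0s2] j1s2 _.
  have nuE r : array_lengths r =
    [seq (la (r i))%:Z - (r i)%:Z + (i : nat)%:Z | i <- s1] ++
    ((la (r j0))%:Z - (r j0)%:Z + j%:Z) ::
    ((la (r j1))%:Z - (r j1)%:Z + j.+1%:Z) ::
    [seq (la (r i))%:Z - (r i)%:Z + (i : nat)%:Z | i <- s2].
    by rewrite /array_lengths enumE map_cat.
  rewrite /D (nuE s) nuE !permM tpermL tpermR.
  have off (t : seq 'I_L) : j0 \notin t -> j1 \notin t ->
    [seq (la ((tperm j0 j1 * s)%g i))%:Z - ((tperm j0 j1 * s)%g i)%:Z
         + (i : nat)%:Z | i <- t] =
    [seq (la (s i))%:Z - (s i)%:Z + (i : nat)%:Z | i <- t].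
    move=> j0t j1t; apply/eq_in_map => i it; rewrite permM tpermD //.
      by apply: contraNneq j0t => ->.
    by apply: contraNneq j1t => ->.
  rewrite !off // -[in LHS]ss1 -[in RHS]ss1.
  have := array_sum_flaw_swap p [seq (la (s i))%:Z - (s i)%:Z + (i : nat)%:Z | i <- s1].
  rewrite size_map ss1 => ->; congr (array_sum _ (_ ++ _ :: _ :: _)); lia.
rewrite /alt_sum; under eq_bigr => s _ do
  rewrite array_sumB ?size_array_lengths // mulrDr.
rewrite big_split /= [X in _ + X](bigID (@odd_perm _)) /=.
rewrite [X in _ + (X + _)](reindex_inj (mulgI (tperm j0 j1))) /=.
rewrite [X in _ + (X + _)](_ : _ = - \sum_(s | ~~ odd_perm s) D s); last first.
  rewrite -sumrN; apply: eq_big => [s|s so].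
    by rewrite odd_permM odd_tperm -(inj_eq val_inj) /= neq_ltn ltnSn.
  by rewrite -/(D _) DE so mulN1r.
rewrite [X in _ + (_ + X)](_ : _ = \sum_(s | ~~ odd_perm s) D s); last first.
  by apply: eq_bigr => s /negPf so; rewrite so mul1r.
by rewrite addNr addr0.
Qed.

Lemma alt_sum_upto p : alt_sum (sorted (stackable_upto p)) = alt_sum xpredT.
Proof.
elim: p => [|p IHp].
  by apply: eq_alt_sum => -[|r P] //= _; elim: P r => //= r' P IH r; rewrite stackable_upto0 IH.
rewrite -IHp; transitivity (alt_sum (mixed p 0)).
  by apply: eq_alt_sum => -[|r P] _; rewrite /mixed /= ?take0 /= ?andbT.
(* At [j = L.-1] the condition only excludes flaws in columns [< p]; at [j = 0] it excludes them in
   column [p] too. *)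
transitivity (alt_sum (mixed p L.-1)).
  have: (L.-1 <= L.-1)%N by [].
  elim: {1 3}L.-1 => // j IHj jL.
  by rewrite IHj 1?ltnW // alt_sum_mixed // -ltn_predRL.
apply: eq_alt_sum => P; case: P => [|r P] // PL.
rewrite /mixed -PL /= take_size.
rewrite [drop _ _](_ : _ = [:: last r P]) ?andbT //.
by rewrite (drop_nth r) //= drop_oversize // nth_last.
Qed.

End JacobiTrudi.

Lemma perm_sorted_enum L (s : 'S_L) :
  sorted (relpre (fun i => s i : nat) ltn) (enum 'I_L) -> s = 1%g.
Proof.
rewrite -sorted_map => s_sorted.
have E : [seq nat_of_ord (s i) | i <- enum 'I_L] = [seq nat_of_ord i | i <- enum 'I_L].
  apply: (irr_sorted_eq ltn_trans ltnn s_sorted).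
    by rewrite val_enum_ord iota_ltn_sorted.
  move=> k; rewrite val_enum_ord mem_iota /= add0n.
  apply/mapP/idP => [[i _ ->] //|kL].
  by exists ((s^-1)%g (Ordinal kL)); rewrite ?mem_enum ?permKV.
apply/permP => i; rewrite perm1; apply: val_inj => /=.
by move/eq_in_map: E; apply; rewrite mem_enum.
Qed.

(* Gasharov's cancellation: only the identity permutation survives, since the
   row lengths of an array without flaws decrease. *)
Lemma JT_tableaux L (la : 'I_L -> nat) :
  (forall i j : 'I_L, (i <= j)%N -> (la j <= la i)%N) ->
  cval (\det (JT sgen la)) =
  array_sum (sorted stackable) [seq (la i)%:Z | i <- enum 'I_L].
Proof.
(* Every row has length [la (s i) - s i + i <= p], so comparing [p] columns is comparing whole
   rows. *)
move=> la_dec; pose p := (\sum_i la i + L)%N.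
have la_p i : (la i + L <= p)%N by rewrite leq_add2r (bigD1 i) //= leq_addr.
rewrite cval_JT -(alt_sum_upto la p) /alt_sum (bigD1 1%g) //= big1 ?addr0 => [|s s1].
  rewrite odd_perm1 mul1r /array_lengths.
  have -> : [seq (la ((1%g : 'S_L) i))%:Z - ((1%g : 'S_L) i)%:Z + (i : nat)%:Z
             | i <- enum 'I_L] = [seq (la i)%:Z | i <- enum 'I_L].
    by apply: eq_map => i; rewrite perm1 subrK.
  apply: eq_array_sum => P /arrays_shape PE.
  apply: (@eq_in_sorted _ (fun r => size r <= p)%N) => [u v _ vp|].
    by rewrite stackable_upto_large.
  apply/allP => r rP; have : (size r)%:Z \in [seq (size r)%:Z | r <- P].
    by apply/mapP; exists r.
  by rewrite -PE => /mapP[i _ [->]]; apply: leq_trans (la_p i); apply: leq_addr.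
rewrite (_ : array_sum _ _ = 0) ?mulr0 // /array_sum big_seq_cond big1 // => P.
case/and3P => /arrays_shape PE _ Psorted; case/eqP: s1; apply: perm_sorted_enum.
have {Psorted} : sorted (fun u v : seq int => size v <= size u)%N P.
  have Pp : all (fun r => size r <= p)%N P.
    apply/allP => r rP; have : (size r)%:Z \in [seq (size r)%:Z | r <- P].
      by apply/mapP; exists r.
    rewrite -PE => /mapP[i _ E]; have := la_p (s i); have := ltn_ord i; lia.
  move: Psorted; rewrite (@eq_in_sorted _ (fun r => size r <= p)%N _ stackable) //.
    by apply: sub_sorted => u v; apply: stackable_size.
  by move=> u v _ vp; rewrite stackable_upto_large.
have -> : sorted (fun u v : seq int => size v <= size u)%N P =
    sorted (relpre (fun r : seq int => (size r)%:Z) (fun a b : int => b <= a)) P.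
  by apply: eq_sorted => u v /=; rewrite lez_nat.
rewrite -sorted_map -PE sorted_map => Pd.
have e_lt : sorted (relpre (@nat_of_ord L) ltn) (enum 'I_L).
  by rewrite -sorted_map val_enum_ord iota_ltn_sorted.
apply: pairwise_sorted; move: Pd e_lt.
rewrite !sorted_pairwise => [Pd e_lt|y x z /=|y x z /=]; last 2 first.
- exact: ltn_trans.
- by move=> yx zy; apply: le_trans yx.
have := conj Pd e_lt => /andP; rewrite -pairwise_relI.
apply: sub_pairwise => i j /= /andP[nu_ij ij].
(* [s j <= s i] would give [la (s i) - s i + i < la (s j) - s j + j], against the decrease of the
   row lengths. *)
rewrite ltnNge; apply/negP => sij.
have := la_dec _ _ sij; lia.
Qed.

(** * Products of columns *)

Lemma big_arrays_ones n (F : seq (seq int) -> A) :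
  \sum_(P <- arrays (nseq n 1)) F P = \sum_(w <- words n) F [seq [:: x] | x <- w].
Proof.
elim: n F => [|n IHn] F; first by rewrite !big_seq1.
rewrite /= big_allpairs_dep /= [RHS]big_allpairs_dep /=.
rewrite (_ : [seq x :: w | x <- letters, w <- [:: [::]]] = [seq [:: x] | x <- letters]).
  by rewrite big_map; apply: eq_bigr => x _; apply: IHn.
by elim: letters => //= x s ->.
Qed.

Lemma big_words_rev n (F : seq int -> A) :
  \sum_(w <- words n) F w = \sum_(w <- words n) F (rev w).
Proof.
rewrite -(big_map (@rev int) xpredT F); apply: perm_big; apply: uniq_perm.
- exact: words_uniq.
- by rewrite map_inj_uniq ?words_uniq //; apply: can_inj (@revK _).
move=> w; apply/idP/mapP => [wn|[v vn ->]].
  by exists (rev w); rewrite ?revK // mem_words size_rev all_rev -mem_words.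
by rewrite mem_words size_rev all_rev -mem_words.
Qed.

(** A single column read from the bottom up turns the condition between adjacent rows into the
    affine Dyck condition, whence the reversal of words. *)
Lemma JT_ones n : cval (\det (JT sgen (fun _ : 'I_n => 1%N))) =
  \sum_(w <- words n | affine_dyck w) wd w.
Proof.
rewrite JT_tableaux // (_ : map _ _ = nseq n 1); last first.
  by rewrite -[in RHS](size_enum_ord n); elim: (enum 'I_n) => //= i s ->.
rewrite /array_sum big_mkcond big_arrays_ones [RHS]big_mkcond [RHS]big_words_rev.
apply: eq_bigr => w _; rewrite /affine_dyck rev_sorted sorted_map.
rewrite (_ : all _ _ = true); last by elim: w.
rewrite (_ : RR _ = rev w); last by elim: w => //= x w IHw; rewrite RR_cons IHw rev_cons cats1.
by congr (if _ then _ else _); apply: eq_sorted => x y /=; rewrite andbT.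
Qed.

Lemma affine_prod (nu : seq nat) :
  \sum_(P <- arrays (map Posz nu) | all affine_dyck P) wd (flatten P) =
  cval (\prod_(n <- nu) \det (JT sgen (fun _ : 'I_n => 1%N))).
Proof.
elim: nu => [|n nu IHnu].
  by rewrite big_mkcond big_seq1 /= wd_nil big_nil.
rewrite big_cons cvalM -IHnu JT_ones big_distrlr /= big_mkcond big_allpairs_dep.
rewrite [RHS]big_mkcond; apply: eq_bigr => w _; case: ifP => wa.
  rewrite [RHS]big_mkcond; apply: eq_bigr => P _ /=.
  by rewrite wa andTb; case: ifP => //; rewrite wd_cat.
by rewrite big1 // => P _ /=; rewrite wa.
Qed.

Lemma sgen_neg k : k < 0 -> sgen k = 0.
Proof. by case: k => // n _; apply: val_inj; rewrite /= gen_neg. Qed.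

Lemma sgen0 : sgen 0 = 1.
Proof. by apply: val_inj; rewrite /= gen0. Qed.

(** Fixing the size [L] in advance gives each Pieri step room for its new parts; the empty product
    is the unitriangular matrix of the empty shape. *)
Lemma prod_ones_cols L (al : nat -> nat) K : (\sum_(r < K) al r <= L)%N ->
  \prod_(n <- [seq al r | r <- iota 0 K]) \det (JT sgen (fun _ : 'I_n => 1%N)) =
  \sum_(C <- cols L al K) \det (JT sgen (fun i => size (C i))).
Proof.
elim: K => [|K IHK].
  move=> _; rewrite big_nil big_seq1; apply/esym.
  rewrite det_trig => [|]; last first.
    apply/is_trig_mxP => i k ik; rewrite mxE ffunE /= sgen_neg //; lia.
  by rewrite big1 // => i _; rewrite mxE ffunE /= [_ + _](_ : _ = 0) ?sgen0 //; lia.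
rewrite big_ord_recr -[X in iota 0 X]addn1 iotaD map_cat big_cat big_seq1 /= => le_L.
rewrite IHK /=; last by lia.
rewrite add0n big_distrl /= big_filter [RHS]big_mkcond big_allpairs_dep.
rewrite big_seq [RHS]big_seq; apply: eq_bigr => C CK.
rewrite Pieri_partitions; last 4 first.
- exact: sgen_neg.
- exact: sgen0.
- exact: cols_part_shape CK.
- by rewrite (cols_size CK).
rewrite big_enum_cond /= -big_mkcondr; apply: eq_big => e.
  rewrite inE andbT; congr (_ && _); apply: eq_forallb => i; apply: eq_forallb => j.
  by rewrite !ffunE; case: (e i); case: (e j); rewrite ?size_rcons ?addn0 ?addn1.
move=> _; congr (\det _); apply/matrixP => i k; rewrite !mxE ffunE.
by case: (e k); rewrite ?size_rcons ?addn0 ?addn1.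
Qed.

(** The theorem for all [S] and [d] at once, at one monomial and over a finite alphabet. *)
Lemma affine_factorizations L (al : nat -> nat) K : (\sum_(r < K) al r <= L)%N ->
  \sum_(P <- arrays [seq (al r)%:Z | r <- iota 0 K] | all affine_dyck P) wd (flatten P) =
  \sum_(C <- cols L al K)
    \sum_(P <- arrays [seq (size (C i))%:Z | i <- enum 'I_L]
          | all dual_dyck P && sorted stackable P) wd (RR P).
Proof.
move=> le_L; rewrite (map_comp Posz) affine_prod (prod_ones_cols le_L).
rewrite raddf_sum big_seq [RHS]big_seq; apply: eq_bigr => C CK.
exact: JT_tableaux (nonincreasing_ord (cols_part_shape CK)).
Qed.

End Alphabet.

(** * The monoid of contents and inversion numbers *)

Lemma di_nil : di [::] = 0%N.
Proof. by apply/eqP; rewrite cards_eq0 -finset.subset0; apply/fintype.subsetP => -[[]]. Qed.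

Lemma diE (w : seq int) :
  di w = (\sum_(i < size w) \sum_(j < size w)
            ((i < j)%N && (w`_i == w`_j + 1)%R))%N.
Proof.
rewrite /di -sum1dep_card big_mkcond /= pair_big /=.
by apply: eq_bigr => -[i j] _ /=; case: ifP.
Qed.

Lemma di_cons (x : int) (w : seq int) :
  di (x :: w) = (count_mem (x - 1)%R w + di w)%N.
Proof.
rewrite !diE /= big_ord_recl big_ord_recl /= add0n; congr (_ + _)%N.
  rewrite -sum1_count (big_nth 0) big_mkord [RHS]big_mkcond /=.
  by apply: eq_bigr => j _; rewrite add0n -subr_eq eq_sym; case: eqP.
by apply: eq_bigr => i _; rewrite big_ord_recl /= add0n.
Qed.

(** The pairs that [di] gains between the two factors of a concatenation; they depend on the
    contents alone, so pairs of content and [di] can be multiplied. *)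
Definition cross (M N : {mset int}%mset) : nat := (\sum_(x <- M) N (x - 1)%R)%N.

Lemma cross_seq (s : seq int) (N : {mset int}%mset) :
  cross (seq_mset s) N = (\sum_(x <- s) N (x - 1)%R)%N.
Proof. by rewrite /cross (perm_big _ (perm_eq_seq_mset s)). Qed.

Lemma cross_mset0l (N : {mset int}%mset) : cross mset0 N = 0%N.
Proof. by rewrite /cross big_mset0. Qed.

Lemma cross_mset0r (M : {mset int}%mset) : cross M mset0 = 0%N.
Proof. by rewrite /cross big1_seq // => x _; rewrite mset0E. Qed.

Lemma seq_mset_cat (s t : seq int) :
  seq_mset (s ++ t) = (seq_mset s `+` seq_mset t)%mset.
Proof. by apply/msetP => a; rewrite msetE2 !mset_seqE count_cat. Qed.

Lemma seq_mset_nil : seq_mset [::] = mset0 :> {mset int}%mset.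
Proof. by apply/msetP => a; rewrite mset_seqE mset0E. Qed.

Lemma crossDl (M M' N : {mset int}%mset) :
  cross (M `+` M')%mset N = (cross M N + cross M' N)%N.
Proof.
by rewrite -(seq_mset_id M) -(seq_mset_id M') -seq_mset_cat !cross_seq big_cat.
Qed.

Lemma crossDr (M N N' : {mset int}%mset) :
  cross M (N `+` N')%mset = (cross M N + cross M N')%N.
Proof.
by rewrite /cross -big_split; apply: eq_bigr => x _; rewrite msetE2.
Qed.

Lemma di_cat (s t : seq int) :
  di (s ++ t) = (di s + di t + cross (seq_mset s) (seq_mset t))%N.
Proof.
elim: s => [|x s IHs] /=.
  by rewrite seq_mset_nil cross_mset0l di_nil addn0.
rewrite !di_cons IHs [cross (seq_mset (x :: s)) _]cross_seq big_cons -cross_seq mset_seqE count_cat.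
rewrite addnACA; congr addn; exact: addnA.
Qed.

(* The pairs (content of w, di w), multiplied so that concatenation of words
   is sent to the product. *)
Definition qmon : Type := ({mset int}%mset * nat)%type.
HB.instance Definition _ := Choice.on qmon.

Definition qone : qmon := (mset0, 0%N).
Definition qmul (u v : qmon) : qmon :=
  ((u.1 `+` v.1)%mset, (u.2 + v.2 + cross u.1 v.1)%N).

Lemma qmulA : associative qmul.
Proof.
by move=> u v w; rewrite /qmul /= msetDA crossDl crossDr; congr pair; lia.
Qed.

Lemma qmul1m : left_id qone qmul.
Proof. by case=> M a; rewrite /qmul /= mset0D cross_mset0l addn0. Qed.

Lemma qmulm1 : right_id qone qmul.
Proof. by case=> M a; rewrite /qmul /= msetD0 cross_mset0r !addn0. Qed.

Lemma qunitm (u v : qmon) : qmul u v = qone -> u = qone /\ v = qone.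
Proof.
case: u v => [M a] [N b]; rewrite /qmul /= => -[/msetP MN0 ab0].
have [/eqP-> /eqP->] : a == 0%N /\ b == 0%N by lia.
by split; congr pair; apply/msetP => x; have := MN0 x;
  rewrite msetE2 mset0E => /eqP; rewrite addn_eq0 => /andP[/eqP ? /eqP ?].
Qed.

HB.instance Definition _ :=
  Choice_isMonomialDef.Build qmon qmulA qmul1m qmulm1 qunitm.

Lemma mmulE (M N : {mset int}%mset) (a b : nat) :
  mmul ((M, a) : qmon) ((N, b) : qmon) = ((M `+` N)%mset, (a + b + cross M N)%N).
Proof. by []. Qed.

Definition qalg : nzRingType := {malg int[qmon]}.

Definition wd (w : seq int) : qalg :=
  mkmalgU ((seq_mset w, di w) : qmon) (1 : int).

Lemma qalgMUU (u v : qmon) (a b : int) :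
  (mkmalgU u a : qalg) * mkmalgU v b = mkmalgU (mmul u v) (a * b).
Proof. exact: fgmulUU. Qed.

Lemma wdU (u v : qmon) :
  (mkmalgU u (1 : int) : qalg) * mkmalgU v (1 : int) = mkmalgU (mmul u v) (1 : int).
Proof. by rewrite qalgMUU mulr1. Qed.

Lemma wd_nil : wd [::] = 1.
Proof. by rewrite /wd seq_mset_nil di_nil. Qed.

Lemma wd_cat (s t : seq int) : wd (s ++ t) = wd s * wd t.
Proof. by rewrite /wd wdU di_cat seq_mset_cat. Qed.

Lemma wd_coef (w : seq int) (S : {mset int}%mset) (d : nat) :
  mcoeff ((S, d) : qmon) (wd w) = ((seq_mset w == S) && (di w == d))%:R.
Proof. by rewrite /wd mcoeffU. Qed.

(** Not the image of a word: the empty content with one inversion, a formal variable recording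
    [di]. *)
Definition qvar : qalg := mkmalgU ((mset0, 1%N) : qmon) (1 : int).

Lemma qvar_central (y : qalg) : qvar * y = y * qvar.
Proof.
rewrite [y]monalgE mulr_sumr mulr_suml; apply: eq_bigr => u _.
rewrite /qvar !qalgMUU mulr1 mul1r.
have -> // : mmul ((mset0, 1%N) : qmon) u = mmul u ((mset0, 1%N) : qmon).
case: u => M a.
rewrite !mmulE mset0D msetD0 cross_mset0l cross_mset0r !addn0.
by rewrite addnC.
Qed.

Lemma cross1 (x y : int) :
  cross (seq_mset [:: x]) (seq_mset [:: y]) = (y == x - 1) :> nat.
Proof. by rewrite cross_seq big_seq1 mset_seqE /= addn0. Qed.

Lemma wd_letters_comm (x y : int) :
  y != x - 1 -> x != y - 1 -> wd [:: x] * wd [:: y] = wd [:: y] * wd [:: x].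
Proof.
move=> /negPf nxy /negPf nyx; rewrite /wd !wdU.
by rewrite !mmulE !cross1 nxy nyx msetDC (addnC (di [:: x])).
Qed.

Lemma wd_near (x : int) :
  wd [:: x + 1] * wd [:: x] = qvar * wd [:: x] * wd [:: x + 1].
Proof.
rewrite /wd /qvar -mulrA !wdU.
rewrite !mmulE mset0D cross_mset0l !cross1 addrK eqxx msetDC.
have -> : (x + 1 == x - 1) = false by apply/eqP; lia.
rewrite -[nat_of_bool true]/1%N -[nat_of_bool false]/0%N !addn0 addn1 add1n.
by rewrite (addnC (di [:: x])).
Qed.

(** * Counting factorizations and tableaux *)

Lemma mem_arrays (letters : seq int) nu P : (P \in arrays letters nu) =
  (nu == [seq (size r)%:Z | r <- P]) && all (all [in letters]) P.
Proof.
elim: nu P => [|k nu IHnu] P /=; first by rewrite inE; case: P.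
apply/allpairsP/idP => [[[r Q] /= [rk Qnu ->]]|].
  have kE := wordsZ_size rk; move: rk Qnu; rewrite kE mem_words IHnu.
  by move=> /andP[_ rl] /andP[/eqP-> Ql]; rewrite /= eqxx rl Ql.
case: P => [|r P] //= /andP[/eqP[-> nuE] /andP[rl Pl]].
by exists (r, P); rewrite /= mem_words eqxx rl IHnu nuE eqxx Pl.
Qed.

Lemma arrays_uniq (letters : seq int) nu : uniq letters -> uniq (arrays letters nu).
Proof.
move=> letters_uniq; elim: nu => //= k nu IHnu; apply: allpairs_uniq => //.
  by case: k => [n|//]; apply: words_uniq.
by move=> [r P] [r' P'] _ _ /= [-> ->].
Qed.

Lemma sorted_stackableP P : sorted stackable P <-> sorted geq (shape P) /\
  forall j p : nat, (j.+1 < size P)%N ->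
    (p < size (nth [::] P j))%N -> (p < size (nth [::] P j.+1))%N ->
    (nth [::] P j)`_p <= (nth [::] P j.+1)`_p + 1.
Proof.
split=> [/(sortedP [::]) okP|[/(sortedP 0%N) P_s Ple]].
  split=> [|j p jP _ pj]; last by have /stackableP[_] := okP _ jP; apply.
  apply/(sortedP 0%N) => j; rewrite size_map => jP; rewrite !nth_shape.
  by have /stackableP[] := okP _ jP.
apply/(sortedP [::]) => j jP; apply/stackableP; split.
  by rewrite -!nth_shape; apply: P_s; rewrite size_map.
move=> p pj; apply: Ple => //; apply: leq_trans pj _.
by rewrite -!nth_shape; apply: P_s; rewrite size_map.
Qed.

Lemma RR_strip P : RR (strip P) = RR P.
Proof. by rewrite /RR /strip -filter_rev -/(strip _) flatten_strip. Qed.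

Lemma seq_mset_RR P : seq_mset (RR P) = seq_mset (flatten P).
Proof.
apply/eq_seq_msetP; elim: P => // r P IHP; rewrite RR_cons /= perm_catC.
by rewrite perm_cat2l.
Qed.

Lemma all_letters (letters : seq int) (S : {mset int}%mset) P :
  seq_mset (flatten P) = S -> {subset S <= letters} -> all (all [in letters]) P.
Proof.
move=> PS Sl; apply/allP => r rP; apply/allP => x xr; apply: Sl.
by rewrite -PS (perm_mem (perm_eq_seq_mset _)); apply/flattenP; exists r.
Qed.

Lemma weightE (F : seq_family) r : weight F r = size (F r).
Proof.
have expE (a : nat) n : expcmn (ucm a) n r = ((a == r) * n)%N :> nat.
  elim: n => [|[|n] IHn]; first by rewrite muln0 cm1.
    by rewrite muln1 cmU.
  have -> : expcmn (ucm a) n.+2 = mmul (ucm a) (expcmn (ucm a) n.+1) by [].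
  by rewrite cmM IHn cmU [RHS]mulnS.
have -> : weight F r = (\sum_(a <- finsupp F) (a == r) * size (F a))%N.
  rewrite /weight; elim: (enum_fset _) => [|a s IHs]; first by rewrite !big_nil cm1.
  by rewrite !big_cons cmM IHs expE.
case: finsuppP => [rF|rF].
  rewrite big1_seq // => a /= aF; case: eqP => // ar.
  by move: rF; rewrite -ar aF.
rewrite (bigD1_seq r) ?fset_uniq //= eqxx mul1n big1 ?addn0 // => a /negPf ->.
by rewrite mul0n.
Qed.

Lemma concatE (F : seq_family) K : (forall r, (K <= r)%N -> F r = [::]) ->
  concat F = flatten [seq F r | r <- iota 0 K].
Proof.
move=> FK; rewrite /concat; set N := (\max_(r <- finsupp F) r)%N.
have FN r : (N.+1 <= r)%N -> F r = [::].
  move=> Nr; apply: fsfun_dflt; apply/negP => rF.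
  by move: Nr; rewrite ltnNge /N (big_fsetD1 r) //= leq_maxl.
have ext n n' : (forall r, (n <= r)%N -> F r = [::]) ->
    flatten [seq F r | r <- iota 0 (n + n')] = flatten [seq F r | r <- iota 0 n].
  move=> Fn; rewrite iotaD map_cat flatten_cat add0n.
  rewrite [X in _ ++ X](_ : _ = [::]) ?cats0 //.
  elim: n' n Fn => //= n' IH n Fn; rewrite Fn // IH // => r /ltnW; exact: Fn.
by rewrite -(ext _ K FN) addnC ext.
Qed.

Definition family_of (P : seq (seq int)) : seq_family :=
  [fsfun r in [fset k | k in iota 0 (size P)]%fset => nth [::] P r].

Lemma family_ofE P r : family_of P r = nth [::] P r.
Proof.
rewrite fsfunE inE /= mem_iota add0n /=.
by case: ltnP => // Pr; rewrite nth_default.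
Qed.

Lemma map_family_of P : [seq family_of P r | r <- iota 0 (size P)] = P.
Proof.
apply: (@eq_from_nth _ [::]) => [|i]; rewrite size_map size_iota // => iP.
by rewrite (nth_map 0%N) ?size_iota // nth_iota // family_ofE.
Qed.

(** A monomial fixes the size of every factor, so factorizations become arrays with prescribed row
    lengths. *)
Lemma DS_coef (letters : seq int) (S : {mset int}%mset) (d K : nat)
    (al : nat -> nat) (m : {cmonom nat}) :
  uniq letters -> {subset S <= letters} ->
  (forall r, m r = if (r < K)%N then al r else 0%N) ->
  DS S d m =
  \sum_(P <- arrays letters [seq (al r)%:Z | r <- iota 0 K] | all affine_dyck P)
    ((seq_mset (flatten P) == S) && (di (flatten P) == d))%:R.
Proof.
move=> letters_uniq Sl mE.
pose c P := [&& all affine_dyck P, seq_mset (flatten P) == S & di (flatten P) == d].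
pose A := arrays letters [seq (al r)%:Z | r <- iota 0 K].
have arrsE P : P \in A -> size P = K /\ forall r, (r < K)%N -> size (nth [::] P r) = al r.
  rewrite mem_arrays => /andP[/eqP PE _].
  have PK : size P = K by have := congr1 size PE; rewrite !size_map size_iota.
  split=> // r rK; have := congr1 (fun s => nth 0 s r) PE.
  by rewrite (nth_map 0%N) ?size_iota // nth_iota // (nth_map [::]) ?PK // => -[].
rewrite /DS (@fps_sum_monom _ _ _ _ [seq family_of P | P <- A & c P]).
- rewrite size_map size_filter -sum1_count natr_sum big_mkcond [RHS]big_mkcond /=.
  by apply: eq_bigr => P _; rewrite /c; case: (all _ P) => //=; case: ifP.
- rewrite map_inj_in_uniq ?filter_uniq ?arrays_uniq // => P P'.
  rewrite !mem_filter => /andP[_ /arrsE[PK _]] /andP[_ /arrsE[P'K _]] E.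
  by rewrite -(map_family_of P) -(map_family_of P') E PK P'K.
move=> F; split=> [/mapP[P]|[[[FS Fa] Fd] Fm]].
  rewrite mem_filter => /andP[/and3P[Pa /eqP PS /eqP Pd] /arrsE[PK Psz]] ->.
  have cE : concat (family_of P) = flatten P.
    rewrite (@concatE _ K) -?PK ?map_family_of // => r Pr.
    by rewrite family_ofE nth_default.
  split; first split; rewrite ?cE //.
    split=> [|r]; first by rewrite /factorization cE.
    rewrite family_ofE; have [rP|Pr] := ltnP r (size P).
      by apply: (allP Pa); apply: mem_nth.
    by rewrite nth_default.
  apply/eqP/cmP => r; rewrite weightE family_ofE mE; case: ltnP => [/Psz//|Kr].
  by rewrite nth_default ?PK.
have FK r : (K <= r)%N -> F r = [::].
  by move=> Kr; apply: size0nil; rewrite -weightE Fm mE ltnNge Kr.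
have cE := concatE FK; pose P := [seq F r | r <- iota 0 K].
have PS : seq_mset (flatten P) = S by rewrite -cE.
apply/mapP; exists P.
  rewrite mem_filter /c -cE Fd eqxx FS eqxx !andbT; apply/andP; split.
    by apply/allP => w /mapP[r _ ->].
  rewrite mem_arrays (all_letters PS Sl) andbT -map_comp; apply/eqP.
  apply/eq_in_map => r; rewrite mem_iota add0n /= => rK.
  by rewrite -weightE Fm mE rK.
apply/fsfunP => r; rewrite family_ofE; have [rK|Kr] := ltnP r K.
  by rewrite (nth_map 0%N) ?size_iota // nth_iota.
by rewrite FK // nth_default // size_map size_iota.
Qed.

(** Both sides count pairs of a Dyck tableau and a list of columns of the same shape, grouped by the
    tableau on the left and by the columns on the right, where the tableau is padded to [L] rows. *)
Lemma tableaux_coef (letters : seq int) (S : {mset int}%mset) (d L K : nat)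
    (al : nat -> nat) (m : {cmonom nat}) :
  uniq letters -> {subset S <= letters} ->
  (\sum_(r < K) al r <= L)%N ->
  (forall r, m r = if (r < K)%N then al r else 0%N) ->
  fps_sum
    [set P | [/\ dyck_tableau P, seq_mset (flatten P) = S & di (RR P) = d]]%classic
    (fun P => schur (conj_part (shape P))) m =
  \sum_(C <- cols L al K)
    \sum_(P <- arrays letters [seq (size (C i))%:Z | i <- enum 'I_L]
          | all dual_dyck P && sorted stackable P)
      ((seq_mset (RR P) == S) && (di (RR P) == d))%:R.
Proof.
move=> letters_uniq Sl le_L mE; set X := [set P | _]%classic.
pose c P := (all dual_dyck P && sorted stackable P) &&
            ((seq_mset (RR P) == S) && (di (RR P) == d)).
pose A (C : {ffun 'I_L -> seq nat}) :=
  arrays letters [seq (size (C i))%:Z | i <- enum 'I_L].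
pose Y C := [seq strip P | P <- A C & c P].
have shapeA C P : P \in A C -> shape P = shape (colseq C).
  rewrite mem_arrays => /andP[/eqP PE _]; apply: (@inj_map _ _ Posz); first by move=> ? ? [].
  by rewrite /shape /colseq -[LHS]map_comp -2![RHS]map_comp; exact: esym PE.
have part_shape_X P : X P -> sorted geq (shape P) /\ 0%N \notin shape P.
  case=> -[P0 Ps _ _] _ _; split=> //; apply/mapP => -[r rP /esym/size0nil r0].
  by rewrite -r0 rP in P0.
have memY C P : C \in cols L al K ->
    (P \in Y C) <-> X P /\ shape (strip (colseq C)) = shape P.
  move=> /colseq_sorted Cs; split=> [/mapP[Q]|[PX PC]].
    rewrite mem_filter => /andP[/andP[/andP[Qd Qok] /andP[/eqP QS /eqP Qdi]] QA] ->.
    have QC := shapeA _ _ QA; have Qs : sorted geq (shape Q) by rewrite QC.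
    have /sorted_stackableP[_ Qle] := Qok.
    have stripE (T T' : eqType) (U : seq (seq T)) (V : seq (seq T')) :
        shape U = shape V -> shape (strip U) = shape (strip V).
      elim: U V => [|u U IH] [|v V] //= [uv /IH UV].
      by rewrite -!size_eq0 -uv; case: (size u == 0)%N; rewrite //= UV uv.
    split; last exact: stripE.
    split; [split|by rewrite flatten_strip -seq_mset_RR|by rewrite RR_strip].
    - exact: strip_neq_nil.
    - exact: strip_sorted.
    - by apply/allP => r; rewrite mem_filter => /andP[_ /(allP Qd)].
    move=> j p jQ; rewrite !nth_strip // => pj pj1; apply: Qle => //.
    by apply: leq_trans jQ _; rewrite size_filter count_size.
  have [[P0 Ps Pd Ple] PS Pdi] := PX.
  pose k := (L - size P)%N; pose Q := P ++ nseq k [::].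
  have QP : strip Q = P by rewrite strip_cat_nseq.
  have shQ : shape Q = shape (colseq C).
    have sP : size P = size (strip (colseq C)).
      by rewrite -(size_map size P) -/(shape P) -PC size_map.
    rewrite [in RHS](strip_pad Cs) /Q /k sP size_colseq /shape !map_cat !map_nseq.
    by congr (_ ++ _); apply: esym PC.
  apply/mapP; exists Q => //; rewrite mem_filter.
  have QS : seq_mset (flatten Q) = S by rewrite -flatten_strip QP.
  apply/andP; split; last first.
    rewrite mem_arrays (all_letters QS Sl) andbT.
    have -> : [seq (size (C i))%:Z | i <- enum 'I_L] = map Posz (shape (colseq C)).
      by rewrite /shape /colseq -2![RHS]map_comp.
    by rewrite -shQ /shape -map_comp.
  rewrite /c seq_mset_RR QS eqxx -RR_strip QP Pdi eqxx !andbT all_cat Pd /=.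
  apply/andP; split; first by elim: (k).
  apply/sorted_stackableP; split; first by rewrite shQ.
  have Qs : sorted geq (shape Q) by rewrite shQ.
  move=> j p _; rewrite -!(nth_strip _ Qs) QP => pj pj1; apply: Ple => //.
  by rewrite ltnNge; apply/negP => Pj; move: pj1; rewrite nth_default.
have Yuniq C : C \in cols L al K -> uniq (Y C).
  move=> /colseq_sorted Cs; rewrite map_inj_in_uniq ?filter_uniq ?arrays_uniq // => P P'.
  rewrite !mem_filter => /andP[_ /shapeA PC] /andP[_ /shapeA P'C] E.
  rewrite (strip_pad (X := P)) ?PC // (strip_pad (X := P')) ?P'C // E.
  by rewrite -(size_map size P) -/(shape P) PC -P'C size_map.
(* The tableaux whose shape occurs among the lists of columns; at [m] all others have Schur
   coefficient 0, so the support is finite. *)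
pose Xl := undup (flatten [seq Y C | C <- cols L al K]).
have memXl P : P \in Xl <-> exists2 C, C \in cols L al K & P \in Y C.
  rewrite mem_undup; split=> [/flattenP[y /mapP[C CK ->] PY]|[C CK PY]].
    by exists C.
  by apply/flattenP; exists (Y C) => //; apply: map_f.
have coefX P : X P -> schur (conj_part (shape P)) m =
    \sum_(C <- cols L al K) (shape (strip (colseq C)) == shape P)%:R.
  by move=> /part_shape_X[Ps P0]; apply: schur_coef.
have XlX P : P \in Xl -> X P by move=> /memXl[C CK /(memY _ _ CK)[]].
rewrite /fps_sum (fsbigE Xl) ?undup_uniq //=; last first.
  move=> P XP PXl; rewrite coefX // big1_seq // => C /= CK.
  case: eqP => // CP; case/negP: PXl; apply/memXl; exists C => //.
  by apply/memY.
rewrite big_seq_cond (eq_bigl [in Xl]) => [|P]; last first.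
  by case PXl: (P \in Xl) => //=; rewrite mem_set //; apply: XlX.
rewrite (eq_bigr (fun P => \sum_(C <- cols L al K)
    (shape (strip (colseq C)) == shape P)%:R)) => [|P /XlX]; last exact: coefX.
rewrite -big_seq exchange_big /= big_seq [RHS]big_seq; apply: eq_bigr => C CK.
transitivity ((size (Y C))%:R : int).
  rewrite -natr_sum; congr (_%:R).
  have -> : size (Y C) = count (fun P => shape (strip (colseq C)) == shape P) Xl.
    rewrite -size_filter; apply: perm_size; apply: uniq_perm.
    - exact: Yuniq.
    - by rewrite filter_uniq ?undup_uniq.
    move=> P; rewrite mem_filter; apply/idP/andP => [PY|[/eqP CP PXl]].
      have /(memY _ _ CK)[_ ->] := PY; split=> //.
      by apply/memXl; exists C.
    by apply/(memY _ _ CK); split=> //; apply: XlX.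
  by rewrite -sum1_count [RHS]big_mkcond; apply: eq_bigr => P _; case: eqP.
rewrite size_map size_filter -sum1_count natr_sum big_mkcond [RHS]big_mkcond /=.
apply: eq_bigr => P _; rewrite /c; case: (_ && sorted _ _) => //=; by case: ifP.
Qed.

Lemma mcoeff_sum (I : Type) (s : seq I) (P : pred I) (F : I -> qalg) (u : qmon) :
  mcoeff u (\sum_(i <- s | P i) F i) = \sum_(i <- s | P i) mcoeff u (F i).
Proof. exact: (raddf_sum (mcoeff u)). Qed.

Theorem corollary3p20 (S : {mset int}%mset) (d : nat) :
  DS S d =
  fps_sum
    [set P | [/\ dyck_tableau P, seq_mset (flatten P) = S & di (RR P) = d]]%classic
    (fun P => schur (conj_part (shape P))).
Proof.
apply/boolp.funext => m.
(* [K] exceeds the index of every variable in [m], and [L] is the degree of [m]. *)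
pose K := (\max_(r <- finsupp m) r).+1; pose L := (\sum_(r < K) m r)%N.
have mE r : m r = if (r < K)%N then m r else 0%N.
  case: ltnP => // Kr; apply: fsfun_dflt; apply/negP => rm.
  by move: Kr; rewrite ltnNge /K (big_fsetD1 r) //= leq_maxl.
pose letters := undup S; have letters_uniq : uniq letters by exact: undup_uniq.
have Sl : {subset S <= letters} by move=> x; rewrite mem_undup.
rewrite (DS_coef d letters_uniq Sl mE) (tableaux_coef d letters_uniq Sl (leqnn L) mE).
have := @affine_factorizations qalg qvar wd qvar_central wd_nil wd_cat wd_letters_comm wd_near
  letters letters_uniq L m K (leqnn L).
move/(congr1 (mcoeff ((S, d) : qmon))); rewrite !mcoeff_sum.
under eq_bigr do rewrite wd_coef.
move->; apply: eq_bigr => C _; rewrite mcoeff_sum.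
by apply: eq_bigr => P _; rewrite wd_coef.
Qed.
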